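(* Let $d\ge 2$ and let $X_1,X_2$ be two independent random vectors in $\mathbb{R}^d$ with common distribution $P$, and let $X_1',X_2'$ be their spherically symmetric variants. Assume that $P$ is absolutely continuous with a square integrable density $p$. Then for any measurable function $h:\mathbb{R}^d\times\mathbb{R}^d\to\mathbb{R}$ satisfying (a) $h(x,y)=0$ if and only if $x=y$, (b) $h(x+a,y+a)=h(x,y)$ for all $a,x,y\in\mathbb{R}^d$, and (c) the class of sets $S_t=\{x\in\mathbb{R}^d : h(0,x)\le t\}$ shrinks regularly towards $0$ as $t\downarrow 0$, we have $$h(X_1,X_2)\stackrel{D}{=}h(X_1,X_2')\stackrel{D}{=}h(X_1',X_2')\quad\text{if and only if } P \text{ is spherically symmetric.}$$
   Context: A random vector $X$ in $\mathbb{R}^d$ (or its distribution) is spherically symmetric (about the origin) if $HX\stackrel{D}{=}X$ for every $d\times d$ orthogonal matrix $H$; $\stackrel{D}{=}$ denotes equality in distribution. The spherically symmetric variants of $X_1,X_2$ are $X_i'=\|X_i\|U_i$, $i=1,2$, where $U_1,U_2$ are i.i.d. uniform on the unit sphere $\mathcal{S}^{d-1}\subset\mathbb{R}^d$ and independent of $(X_1,X_2)$. A family of measurable sets $S_t$ ($t>0$) shrinks regularly towards $0$ as $t\downarrow0$ (in the sense of Wheeden and Zygmund) if the diameters of $S_t$ tend to $0$ and there is a constant $k$, independent of $t$, such that, if $Q_t$ is the smallest cube centered at $0$ containing $S_t$, then $|Q_t|\le k|S_t|$, where $|\cdot|$ is Lebesgue measure.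
   Formalization: In (c), each S_t (t>0) is also required to have positive Lebesgue measure; otherwise h(x,y)=1 for x≠y, 0 for x=y, with S_t={0} for small t and a degenerate cube, would satisfy (c) and make the claim false. *)

(* Defs.v *)
From HB Require Import structures.
From mathcomp Require Import all_boot all_order all_algebra.
From mathcomp Require Import all_classical all_reals all_analysis.
Set Implicit Arguments.
Unset Strict Implicit.
Unset Printing Implicit Defensive.
Import Order.TTheory GRing.Theory Num.Theory.
Import numFieldNormedType.Exports.
Local Open Scope classical_set_scope.
Local Open Scope ring_scope.

(* Vectors of R^d are column vectors 'cV[R]_d.  They carry the sigma-algebra
   generated by the coordinates, i.e. the Borel sigma-algebra of R^d; this is
   the analogue of the library's instance on n.-tuple R. *)
Fact cV_display : measure_display.
Proof. exact: default_measure_display. Qed.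

Section measurable_cV.
Context {R : realType} (n : nat).

Let coors : 'I_n -> 'cV[R]_n -> R := fun i x => x i ord0.

Let cV_set0 : g_sigma_preimage coors set0.
Proof. exact: sigma_algebra0. Qed.

Let cV_setC A : g_sigma_preimage coors A -> g_sigma_preimage coors (~` A).
Proof. exact: sigma_algebraC. Qed.

Let cV_bigcup (F : _^nat) : (forall i, g_sigma_preimage coors (F i)) ->
  g_sigma_preimage coors (\bigcup_i (F i)).
Proof. exact: sigma_algebra_bigcup. Qed.

HB.instance Definition _ := @isMeasurable.Build cV_display
  'cV[R]_n (g_sigma_preimage coors) cV_set0 cV_setC cV_bigcup.

End measurable_cV.

Lemma measurable_coord (R : realType) n (i : 'I_n) :
  measurable_fun [set: 'cV[R]_n] (fun x : 'cV[R]_n => x i ord0).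
Proof.
move=> _ Y mY; rewrite setTI; apply: sub_sigma_algebra => /=.
rewrite -bigcup_seq/=; exists i => /=; first by rewrite mem_index_enum.
by exists Y => //; rewrite setTI.
Qed.

Lemma measurable_fun_cVP (R : realType) d (T : measurableType d) n
    (f : T -> 'cV[R]_n) :
  measurable_fun [set: T] f <->
  forall i, measurable_fun [set: T] (fun t => f t i ord0).
Proof.
split=> [mf i|mf].
  exact: (measurableT_comp (measurable_coord i) mf).
suff H : (@measurable _ 'cV[R]_n) `<=` [set A | measurable (f @^-1` A)].
  by move=> _ A mA; rewrite setTI; exact: (H _ mA).
apply: smallest_sub.
  split=> [|A /= mA|F mF] /=.
  - by rewrite preimage_set0.
  - by rewrite setTD preimage_setC; exact: measurableC.
  - by rewrite preimage_bigcup; apply: bigcup_measurable => k _; exact: mF.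
rewrite -bigcup_seq; apply: bigcup_sub => i _ _ [B mB <-] /=.
by have := mf i measurableT B mB; rewrite !setTI.
Qed.

(* Lebesgue measure on R^n, by induction on n: the image of the product of
   one-dimensional Lebesgue measure and Lebesgue measure on R^n under
   (a, v) |-> col_mx a v. *)
Section lebesgue_step.
Context {R : realType} (n : nat).
Variable mu : {sigma_finite_measure set 'cV[R]_n -> \bar R}.

Definition cons_cV (p : measurableTypeR R * 'cV[R]_n) : 'cV[R]_n.+1 :=
  col_mx (p.1)%:M p.2.

Definition uncons_cV (x : 'cV[R]_n.+1) : measurableTypeR R * 'cV[R]_n :=
  (x ord0 ord0, \col_i x (lift ord0 i) ord0).

Lemma cons_cV0 p : cons_cV p ord0 ord0 = p.1.
Proof.
rewrite /cons_cV (_ : @ord0 n = lshift n (@ord0 0)); last exact: val_inj.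
by rewrite (@col_mxEu _ 1 n 1) mxE eqxx mulr1n.
Qed.

Lemma cons_cVS p i : cons_cV p (lift ord0 i) ord0 = p.2 i ord0.
Proof.
rewrite /cons_cV (_ : lift ord0 i = rshift 1 i); last exact: val_inj.
by rewrite (@col_mxEd _ 1 n 1).
Qed.

Lemma cons_cVK : cancel cons_cV uncons_cV.
Proof.
move=> p; rewrite /uncons_cV cons_cV0 [RHS]surjective_pairing; congr pair.
by apply/matrixP => i j; rewrite mxE cons_cVS (ord1 j).
Qed.

Lemma measurable_cons_cV : measurable_fun setT cons_cV.
Proof.
apply/measurable_fun_cVP => i; case: (unliftP ord0 i) => [j|] ->.
  under eq_fun do rewrite cons_cVS.
  exact: (measurableT_comp (measurable_coord j)).
under eq_fun do rewrite cons_cV0.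
exact: measurable_fst.
Qed.

Lemma measurable_uncons_cV : measurable_fun setT uncons_cV.
Proof.
apply/measurable_fun_pair => /=; first exact: measurable_coord.
apply/measurable_fun_cVP => i.
under eq_fun do rewrite mxE.
exact: measurable_coord.
Qed.

Definition lebesgue_step : set 'cV[R]_n.+1 -> \bar R :=
  pushforward (lebesgue_measure \x mu)%E cons_cV.

Let lebesgue_step0 : lebesgue_step set0 = 0%E.
Proof. by rewrite /lebesgue_step /pushforward preimage_set0 measure0. Qed.

Let lebesgue_step_ge0 A : (0 <= lebesgue_step A)%E.
Proof. by rewrite /lebesgue_step /pushforward measure_ge0. Qed.

Let lebesgue_step_additive : semi_sigma_additive lebesgue_step.
Proof.
move=> F mF tF mUF; rewrite /lebesgue_step /pushforward preimage_bigcup.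
have mpre A : measurable A -> measurable (cons_cV @^-1` A).
  by move=> mA; rewrite -[X in measurable X]setTI; exact: measurable_cons_cV.
apply: measure_semi_sigma_additive.
- by move=> k; exact: mpre.
- apply/trivIsetP => /= i j _ _ ij; rewrite -preimage_setI.
  by move/trivIsetP : tF => /(_ _ _ _ _ ij) ->//; rewrite preimage_set0.
- by rewrite -preimage_bigcup; exact: mpre.
Qed.

HB.instance Definition _ := isMeasure.Build _ _ _ lebesgue_step
  lebesgue_step0 lebesgue_step_ge0 lebesgue_step_additive.

Let lebesgue_step_sigma_finite : sigma_finite setT lebesgue_step.
Proof.
have /sigma_finiteP[F [TF ndF Foo]] := sigma_finiteT (@lebesgue_measure R).
have /sigma_finiteP[G [TG ndG Goo]] := sigma_finiteT mu.
exists (fun k => uncons_cV @^-1` (F k `*` G k)).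
  rewrite -preimage_bigcup (_ : \bigcup_k _ = setT) ?preimage_setT//.
  rewrite -setXTT TF TG predeqE => -[x y]; split.
    by move=> [k _ []/= ? ?]; split; exists k.
  move=> [/= [k _ Fkx] [l _ Gly]]; exists (maxn k l) => //; split.
  - by move: x Fkx; exact/subsetPset/ndF/leq_maxl.
  - by move: y Gly; exact/subsetPset/ndG/leq_maxr.
move=> k; have [mFk Fkoo] := Foo k; have [mGk Gkoo] := Goo k; split.
  rewrite -[X in measurable X]setTI; apply: measurable_uncons_cV => //.
  exact: measurableX.
rewrite /lebesgue_step /pushforward -comp_preimage.
rewrite (_ : _ \o _ = id); last by apply/funext => p; exact: cons_cVK.
by rewrite preimage_id product_measure1E// lte_mul_pinfty// ge0_fin_numE.
Qed.

HB.instance Definition _ := Measure_isSigmaFinite.Build _ _ _ lebesgue_step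
  lebesgue_step_sigma_finite.

End lebesgue_step.

Fixpoint lebesgue_cV (R : realType) (n : nat) :
    {sigma_finite_measure set 'cV[R]_n -> \bar R} :=
  match n with
  | 0 => \d_(0 : 'cV[R]_0)
  | n'.+1 => lebesgue_step (lebesgue_cV R n')
  end.

(* lebesgue_cV is the product measure. *)
Lemma lebesgue_cV_box (R : realType) n (A : 'I_n -> set R) :
  (forall i, measurable (A i)) ->
  lebesgue_cV R n [set x | forall i, A i (x i ord0)] =
  (\prod_(i < n) lebesgue_measure (A i : set (measurableTypeR R)))%E.
Proof.
elim: n A => [|n IHn] A mA.
  rewrite big_ord0 /= diracE (_ : _ \in _ = true)//.
  by apply/mem_set => -[].
rewrite big_ord_recl -(IHn (fun i => A (lift ord0 i)))//=.
pose B : set 'cV[R]_n := [set x | forall i, A (lift ord0 i) (x i ord0)].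
have mB : measurable B.
  rewrite (_ : B = \bigcap_(i in [set: 'I_n])
      ((fun x : 'cV[R]_n => x i ord0) @^-1` A (lift ord0 i))).
    apply: fin_bigcap_measurable => // i _.
    by rewrite -[X in measurable X]setTI; exact: measurable_coord.
  by apply/seteqP; split => [x Bx i _|x Bx i]; exact: Bx.
rewrite -/B -[RHS](product_measure1E (@lebesgue_measure R))//; last first.
  exact: (mA ord0).
rewrite /lebesgue_step /pushforward.
congr (_ _); apply/seteqP; split => [p /= Ap|p /= [A0 AS] i].
  by split=> [|i]; rewrite -?cons_cV0 -?cons_cVS; exact: Ap.
by case: (unliftP ord0 i) => [j|] ->; rewrite ?cons_cV0 ?cons_cVS.
Qed.

Section euclidean.
Context {R : realType} {d : nat}.
Implicit Types (x y : 'cV[R]_d) (S : set 'cV[R]_d).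

(* The library norm on matrices is the sup norm, not the Euclidean one. *)
Definition enorm x : R := Num.sqrt (\sum_(i < d) x i ord0 ^+ 2).

Definition diameter S : \bar R :=
  ereal_sup [set (enorm (z.1 - z.2))%:E | z in S `*` S].

Definition centered_cube (r : R) : set 'cV[R]_d :=
  [set x | forall i, `|x i ord0| <= r].

Definition smallest_centered_cube (r : R) S :=
  [/\ 0 < r, S `<=` centered_cube r &
    forall s : R, 0 < s -> S `<=` centered_cube s -> r <= s].

(* The requirement of positive measure is implicit in the notion, whose purpose
   is to take averages over the S t; without it the sets S t = {0} would count
   as shrinking regularly.  For a t such that S t is unbounded there is no cube
   containing S t, and the condition on k is empty. *)
Definition shrinks_regularly (S : R -> set 'cV[R]_d) :=
  [/\ forall t : R, 0 < t -> measurable (S t),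
      forall t : R, 0 < t -> (0 < lebesgue_cV R d (S t))%E,
      diameter (S t) @[t --> 0^'+] --> 0%E &
      exists k : R, forall t r : R, 0 < t -> smallest_centered_cube r (S t) ->
        (lebesgue_cV R d (centered_cube r) <= k%:E * lebesgue_cV R d (S t))%E].

Definition orthogonal_mx (H : 'M[R]_d) := H^T *m H = 1%:M.

Definition unit_ball : set 'cV[R]_d := [set x | enorm x <= 1].

Definition cone (A : set 'cV[R]_d) : set 'cV[R]_d :=
  [set x | 0 < enorm x <= 1 /\ A ((enorm x)^-1 *: x)].

(* Normalized surface measure of the unit sphere: the surface area of a subset A
   of the sphere is d times the volume of the cone {r u | 0 < r <= 1, u in A},
   and the factor d cancels in the normalization. *)
Definition uniform_sphere (A : set 'cV[R]_d) : \bar R :=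
  (lebesgue_cV R d (cone A) * (fine (lebesgue_cV R d unit_ball))^-1%:E)%E.

End euclidean.

Section laws.
Context {R : realType}.

Definition same_law dT (T : measurableType dT) (mu nu : set T -> \bar R) :=
  forall A, measurable A -> mu A = nu A.

Definition eq_in_law dO (Omega : measurableType dO) (Pr : probability Omega R)
    dT (T : measurableType dT) (X Y : Omega -> T) :=
  same_law (pushforward Pr X) (pushforward Pr Y).

Definition independent_vars dO (Omega : measurableType dO)
    (Pr : probability Omega R) dT (T : measurableType dT) dT' (T' : measurableType dT')
    (X : Omega -> T) (Y : Omega -> T') :=
  forall A B, measurable A -> measurable B ->
    Pr (X @^-1` A `&` Y @^-1` B) = (Pr (X @^-1` A) * Pr (Y @^-1` B))%E.

Definition spherically_symmetric d (mu : set 'cV[R]_d -> \bar R) :=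
  forall H : 'M[R]_d, orthogonal_mx H ->
    same_law (pushforward mu (fun x : 'cV[R]_d => H *m x)) mu.

Definition spherical_variant (Omega : Type) d (X U : Omega -> 'cV[R]_d) :
    Omega -> 'cV[R]_d :=
  fun w => enorm (X w) *: U w.

Definition has_density d (mu : set 'cV[R]_d -> \bar R) (p : 'cV[R]_d -> R) :=
  [/\ measurable_fun setT p, forall x, 0 <= p x &
      forall A, measurable A -> mu A = (\int[lebesgue_cV R d]_(x in A) (p x)%:E)%E].

Definition square_integrable d (p : 'cV[R]_d -> R) :=
  (lebesgue_cV R d).-integrable setT (fun x => (p x ^+ 2)%:E).

End laws.

(* Main.v *)
Require Import Defs.
From HB Require Import structures.
From mathcomp Require Import all_boot all_order all_algebra.
From mathcomp Require Import all_classical all_reals all_analysis.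
From mathcomp Require Import measurable_realfun ring lra.
Set Implicit Arguments.
Unset Strict Implicit.
Unset Printing Implicit Defensive.
Import Order.TTheory GRing.Theory Num.Theory.
Import numFieldNormedType.Exports.
Local Open Scope classical_set_scope.
Local Open Scope ring_scope.

(* Let q be the spherical average of the density p; it is a density of |X|U.
   Since h(x, y) <= t means y - x in S_t, the first equality in law says that the
   correlations z |-> int p(x) p(x + z) dx and z |-> int p(x) q(x + z) dx have the
   same integral over S_t.  Near z = 0 the former is at least |p|^2 - eps, because
   translations are continuous in measure, and the latter is at most
   (|p|^2 + |q|^2) / 2 everywhere; hence |p| <= |q|.  In polar coordinates
   averaging is a symmetric projection of L^2, so p = q almost everywhere and P is
   the law of |X|U, which is rotation invariant because Lebesgue measure is.

   Conversely, if P is spherically symmetric, then the mass that P gives to a ball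
   depends only on the radius and on the norm of the center, so the sets
   S = {|x| <= delta} satisfy the same equality and the argument above shows that P
   is the law of |X|U, whence all three pairs have law P x P. *)

(** * Measurability in R^d *)

(** Lebesgue measure is built coordinate by coordinate, a construction that hides rotations and
    dilations. Both are recovered from translation invariance: an additive bijection multiplies
    volumes by a constant, which is read off the unit ball. The constant is 1 for rotations; for
    dilations, the argument makes the volume of a truncated cone proportional to that of a ball, and
    this is what factors Lebesgue measure into radius and direction. The function q is an average
    with values in the extended reals, and its square integrability is not known in advance. Hence
    no difference involving |q|^2 is formed: cross terms stay on the other side of an equation, and
    2ab <= a^2 + b^2 stands in for Cauchy-Schwarz. Since that bound holds for every z, continuity of
    translations is needed only for p, and only as a lower bound, which monotone approximation by
    simple functions provides. *)

Local Notation pushforward_measure :=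
  measure_function_pushforward__canonical__measure_function_Measure.

Section measurability.
Context {R : realType} {dT} {T : measurableType dT} {n : nat}.
Implicit Types f g : T -> 'cV[R]_n.

Lemma measurable_coordT f i : measurable_fun setT f ->
  measurable_fun setT (fun t => f t i ord0).
Proof. by move=> mf; exact: (measurableT_comp (measurable_coord i) mf). Qed.

Lemma measurable_cVD f g : measurable_fun setT f -> measurable_fun setT g ->
  measurable_fun setT (fun t => f t + g t).
Proof.
move=> mf mg; apply/measurable_fun_cVP => i; under eq_fun do rewrite mxE.
by apply: measurable_funD; exact: measurable_coordT.
Qed.

Lemma measurable_cVN f : measurable_fun setT f ->
  measurable_fun setT (fun t => - f t).
Proof.
move=> mf; apply/measurable_fun_cVP => i; under eq_fun do rewrite mxE.
by apply: measurableT_comp => //; exact: measurable_coordT.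
Qed.

Lemma measurable_cVB f g : measurable_fun setT f -> measurable_fun setT g ->
  measurable_fun setT (fun t => f t - g t).
Proof. by move=> mf mg; apply: measurable_cVD => //; exact: measurable_cVN. Qed.

Lemma measurable_cVZ (k : T -> R) f : measurable_fun setT k ->
  measurable_fun setT f -> measurable_fun setT (fun t => k t *: f t).
Proof.
move=> mk mf; apply/measurable_fun_cVP => i; under eq_fun do rewrite mxE.
by apply: measurable_funM => //; exact: measurable_coordT.
Qed.

Lemma measurable_cVmul (H : 'M[R]_n) f : measurable_fun setT f ->
  measurable_fun setT (fun t => H *m f t).
Proof.
move=> mf; apply/measurable_fun_cVP => i; under eq_fun do rewrite mxE.
apply: measurable_sum => j; apply: measurable_funM => //.
exact: measurable_coordT.
Qed.

Lemma measurable_enorm f : measurable_fun setT f ->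
  measurable_fun setT (fun t => enorm (f t)).
Proof.
move=> mf; rewrite /enorm.
have ms : measurable_fun setT (fun t => \sum_(i < n) f t i ord0 ^+ 2).
  apply: measurable_sum => i; apply: measurable_funX; exact: measurable_coordT.
exact: (measurableT_comp (continuous_measurable_fun (@sqrt_continuous R)) ms).
Qed.

End measurability.

Lemma measurable_preimageT {d1 d2} {T1 : measurableType d1} {T2 : measurableType d2}
  (f : T1 -> T2) A : measurable_fun setT f -> measurable A -> measurable (f @^-1` A).
Proof. by move=> mf mA; rewrite -[X in measurable X]setTI; exact: mf. Qed.

(** * Translation invariance of Lebesgue measure *)

Lemma lebesgue_measure_translate (R : realType) (a : R) (A : set (measurableTypeR R)) :
  measurable A ->
  lebesgue_measure ((fun x : measurableTypeR R => x + a : measurableTypeR R) @^-1` A) =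
  lebesgue_measure A.
Proof.
move=> mA.
have mf : measurable_fun setT (fun x : measurableTypeR R => x + a : measurableTypeR R).
  exact: measurable_funD.
rewrite -[LHS]/(pushforward lebesgue_measure
  (fun x : measurableTypeR R => x + a : measurableTypeR R) A).
apply/esym.
apply: (lebesgue_measure_unique (mu := pushforward_measure lebesgue_measure mf)) => // _ /ocitvP[->|[x xr ->]].
  by rewrite !measure0.
rewrite /= /pushforward lebesgue_measure_itv/=.
rewrite (_ : _ @^-1` _ = [set` `](x.1 - a), (x.2 - a)]]); last first.
  by apply/seteqP; split=> y /=; rewrite !in_itv/= ltrBlDr lerBrDr.
rewrite lebesgue_measure_itv/= !lte_fin ltrD2r -EFinB; case: ifP => // _.
by rewrite -!EFinB; congr (_ %:E); lra.
Qed.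

(** A translation acts on each coordinate separately, so through [cons_cV] it becomes a product of
    translations, and a product measure is determined by its values on rectangles. *)
Lemma lebesgue_cV_translate (R : realType) n (a : 'cV[R]_n) A : measurable A ->
  lebesgue_cV R n ((fun x => x + a) @^-1` A) = lebesgue_cV R n A.
Proof.
elim: n a A => [|n IHn] a A mA.
  congr (_ _); apply/seteqP; split => x /=; by rewrite (flatmx0 (x + a)) (flatmx0 x).
rewrite /= /lebesgue_step /pushforward.
set B := (X in _ = product_measure1 _ _ X).
have mB : measurable B by rewrite -[X in measurable X]setTI; exact: measurable_cons_cV.
pose tau (z : measurableTypeR R * 'cV[R]_n) : measurableTypeR R * 'cV[R]_n :=
  (z.1 + (uncons_cV a).1, z.2 + (uncons_cV a).2).
have mtau : measurable_fun setT tau.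
  apply/measurable_fun_pair => /=.
    by apply: measurable_funD => //; exact: measurable_fst.
  by apply: measurable_cVD => //; exact: measurable_snd.
have tauE z : cons_cV z + a = cons_cV (tau z).
  apply/matrixP => i j; rewrite (ord1 j) [LHS]mxE.
  by case: (unliftP ord0 i) => [k|] ->; rewrite ?cons_cVS ?cons_cV0//= !mxE.
rewrite (_ : _ @^-1` _ = tau @^-1` B); last first.
  by apply/seteqP; split => z; rewrite /B /= tauE.
rewrite -[LHS]/(pushforward_measure (lebesgue_measure \x lebesgue_cV R n)%E mtau B).
apply/esym/product_measure_unique => // C D mC mD.
rewrite /= /pushforward.
rewrite -[_ @^-1` _]/(((fun x : measurableTypeR R => x + _ : measurableTypeR R) @^-1` C) `*` ((fun x => x + _) @^-1` D)).
rewrite product_measure1E; last 2 first.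
- by apply: measurable_preimageT => //; exact: measurable_funD.
- by apply: measurable_preimageT => //; exact: measurable_cVD.
congr (_ * _)%E; first exact: (lebesgue_measure_translate (a ord0 ord0) mC).
exact: IHn.
Qed.

(** * Haar uniqueness for Lebesgue measure *)

Section haar.
Context {R : realType} {d : nat}.
Notation lam := (lebesgue_cV R d).
Notation V := ('cV[R]_d).

Lemma ge0_integral_translate (a : V) (f : V -> \bar R) :
  measurable_fun setT f -> (forall x, 0 <= f x)%E ->
  (\int[lam]_x f (x + a)%R = \int[lam]_x f x)%E.
Proof.
move=> mf f0.
have mt : measurable_fun setT (fun x : V => x + a) by exact: measurable_cVD.
transitivity (\int[pushforward_measure lam mt]_x f x)%E.
  by rewrite ge0_integral_pushforward// preimage_setT.
by apply: eq_measure_integral => A mA _; exact: lebesgue_cV_translate.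
Qed.

Lemma integral_indic_comp d1 (T : measurableType d1) (mu : {measure set T -> \bar R})
  dS (S : measurableType dS) (g : T -> S) A : measurable_fun setT g -> measurable A ->
  (\int[mu]_x (\1_A (g x) : R)%:E = mu (g @^-1` A))%E.
Proof.
move=> mg mA; rewrite -[in RHS](setIT (g @^-1` A)) -integral_indic//.
exact: measurable_preimageT.
Qed.

(* Uniqueness of Haar measure: both sides are the integral of
   1_A(H x) 1_B(y - H x), computed in the two orders. *)
Lemma lebesgue_cV_additive (H K : V -> V) (A B : set V) :
  {morph H : x y / x + y} -> cancel K H -> measurable_fun setT H ->
  measurable_fun setT K -> measurable A -> measurable B ->
  (lam (H @^-1` A) * lam B = lam A * lam ((fun x => - H x)%R @^-1` B))%E.
Proof.
move=> HD KK mH mK mA mB.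
pose f (z : V * V) : \bar R := (\1_A (H z.1) * \1_B (z.2 - H z.1))%:E.
have mind dT (T : measurableType dT) (g : T -> V) C : measurable C ->
    measurable_fun setT g -> measurable_fun setT (fun x => \1_C (g x) : R).
  by move=> mC mg; exact: (measurableT_comp (measurable_indic mC) mg).
have mf : measurable_fun setT f.
  apply/measurable_EFinP; apply: measurable_funM; apply: mind => //.
    by apply: measurableT_comp => //; exact: measurable_fst.
  apply: measurable_cVB; first exact: measurable_snd.
  by apply: measurableT_comp => //; exact: measurable_fst.
have f0 z : (0 <= f z)%E by rewrite lee_fin mulr_ge0.
transitivity (\int[lam]_x \int[lam]_y f (x, y))%E.
  transitivity (\int[lam]_x (lam B * (\1_A (H x) : R)%:E))%E.
    rewrite ge0_integralZl//; last by apply/measurable_EFinP; exact: mind.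
    by rewrite integral_indic_comp// muleC.
  apply: eq_integral => x _; rewrite /f /= muleC.
  under [RHS]eq_integral do rewrite EFinM.
  rewrite ge0_integralZl_EFin//; last first.
    by apply/measurable_EFinP; apply: mind => //; exact: measurable_cVB.
  rewrite (ge0_integral_translate (- H x) (f := fun y => (\1_B y)%:E))//; last first.
    by apply/measurable_EFinP; exact: measurable_indic.
  by rewrite integral_indic// setIT.
rewrite (fubini_tonelli f mf f0).
(* The substitution x = w + [K] y turns [H] x into [H] w + y and y - [H] x into - [H] w. *)
transitivity (\int[lam]_y \int[lam]_w (\1_A (H w + y)%R * \1_B (- H w)%R)%:E)%E.
  apply: eq_integral => y _.
  rewrite -(ge0_integral_translate (K y) (f := fun x => f (x, y)))//; last first.
    exact: measurableT_comp.
  by apply: eq_integral => w _; rewrite /f /= HD KK opprD addrCA subrr addr0.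
pose g (z : V * V) : \bar R := (\1_A (H z.2 + z.1) * \1_B (- H z.2))%:E.
have mg : measurable_fun setT g.
  apply/measurable_EFinP; apply: measurable_funM; apply: mind => //.
    apply: measurable_cVD; last exact: measurable_fst.
    by apply: measurableT_comp => //; exact: measurable_snd.
  by apply: measurable_cVN; apply: measurableT_comp => //; exact: measurable_snd.
have g0 z : (0 <= g z)%E by rewrite lee_fin mulr_ge0.
rewrite (fubini_tonelli g mg g0).
transitivity (\int[lam]_w (lam A * (\1_B (- H w) : R)%:E))%E; last first.
  rewrite ge0_integralZl//; last first.
    by apply/measurable_EFinP; apply: mind => //; exact: measurable_cVN.
  rewrite (integral_indic_comp _ (g := fun w => - H w))//.
  exact: measurable_cVN.
apply: eq_integral => w _; rewrite /g /= muleC.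
under eq_integral do rewrite mulrC EFinM addrC.
rewrite ge0_integralZl_EFin//; last first.
  by apply/measurable_EFinP; apply: mind => //; exact: measurable_cVD.
rewrite (ge0_integral_translate (H w) (f := fun y => (\1_A y)%:E))//; last first.
  by apply/measurable_EFinP; exact: measurable_indic.
by rewrite integral_indic// setIT.
Qed.

End haar.

(** * The Euclidean norm *)

Section norm.
Context {R : realType} {d : nat}.
Notation lam := (lebesgue_cV R d).
Notation V := ('cV[R]_d).
Implicit Types (x y : V) (S : set V).

Lemma sqr_enorm x : enorm x ^+ 2 = \sum_(i < d) x i ord0 ^+ 2.
Proof. by rewrite sqr_sqrtr// sumr_ge0// => i _; exact: sqr_ge0. Qed.

Lemma enorm_ge0 x : 0 <= enorm x.
Proof. exact: sqrtr_ge0. Qed.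

Lemma enormZ k x : enorm (k *: x) = `|k| * enorm x.
Proof.
rewrite -[`|k| * _]ger0_norm ?mulr_ge0 ?enorm_ge0// -sqrtr_sqr exprMn sqr_enorm.
rewrite real_normK ?num_real// mulr_sumr; congr Num.sqrt.
by apply: eq_bigr => i _; rewrite mxE exprMn.
Qed.

Lemma enormN x : enorm (- x) = enorm x.
Proof. by rewrite -scaleN1r enormZ normrN normr1 mul1r. Qed.

Lemma ler_coord_enorm x i : `|x i ord0| <= enorm x.
Proof.
rewrite -sqrtr_sqr; apply: ler_wsqrtr.
by rewrite (bigD1 i)//= lerDl sumr_ge0// => j _; exact: sqr_ge0.
Qed.

Lemma enorm_eq0 x : (enorm x == 0) = (x == 0).
Proof.
apply/eqP/eqP => [x0|->].
  apply/matrixP => i j; rewrite (ord1 j) mxE; apply/eqP.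
  by rewrite -normr_le0 -x0 ler_coord_enorm.
by rewrite -(scale0r (0 : V)) enormZ normr0 mul0r.
Qed.

Lemma enorm_orthogonal (H : 'M[R]_d) x : orthogonal_mx H -> enorm (H *m x) = enorm x.
Proof.
have sq y : \sum_(i < d) y i ord0 ^+ 2 = (y^T *m y) ord0 ord0.
  by rewrite mxE; apply: eq_bigr => i _; rewrite mxE expr2.
move=> HH; rewrite /enorm !sq; congr (Num.sqrt (_ _ _)).
by rewrite trmx_mul mulmxA -(mulmxA x^T) HH mulmx1.
Qed.

Lemma measurable_cube (r : R) : measurable (centered_cube r : set V).
Proof.
rewrite (_ : centered_cube r = \bigcap_(i in [set: 'I_d])
    ((fun x : V => x i ord0) @^-1` [set y | `|y| <= r])).
  apply: fin_bigcap_measurable => // i _.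
  apply: measurable_preimageT; first exact: measurable_coord.
  rewrite (_ : [set y | _] = `[- r, r]%classic)//.
  by apply/seteqP; split => y /=; rewrite in_itv/= ler_norml.
by apply/seteqP; split => [x Bx i _|x Bx i]; exact: Bx.
Qed.

Lemma lebesgue_cube_fin (r : R) : (lam (centered_cube r) < +oo)%E.
Proof.
rewrite (lebesgue_cV_box (A := fun=> [set y | `|y| <= r])).
  rewrite ltey_eq; apply/orP; left; apply: (big_ind (fun x : \bar R => x \is a fin_num)) => //.
    by move=> x y fx fy; rewrite fin_numM.
  move=> i _; rewrite (_ : [set y | _] = `[- r, r]%classic).
    by rewrite lebesgue_measure_itv/=; case: ifP.
  by apply/seteqP; split => y /=; rewrite in_itv/= ler_norml.
move=> _; rewrite (_ : [set y | _] = `[- r, r]%classic)//.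
by apply/seteqP; split => y /=; rewrite in_itv/= ler_norml.
Qed.

Definition eball (r : R) : set V := [set x | enorm x <= r].

Lemma measurable_eball r : measurable (eball r).
Proof.
rewrite (_ : eball r = enorm @^-1` `]-oo, r]%classic); last first.
  by apply/seteqP; split => x /=; rewrite in_itv.
apply: measurable_preimageT => //; exact: measurable_enorm.
Qed.

Lemma eball_cube r : eball r `<=` centered_cube r.
Proof. by move=> x xr i; rewrite (le_trans (ler_coord_enorm _ _)). Qed.

Lemma lebesgue_subcube_fin r S : measurable S -> S `<=` centered_cube r ->
  (lam S < +oo)%E.
Proof.
move=> mS Sr; apply: le_lt_trans (lebesgue_cube_fin r).
by apply: le_measure => //; rewrite inE//; exact: measurable_cube.
Qed.

Lemma lebesgue_eball_fin r : (lam (eball r) < +oo)%E.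
Proof. exact: lebesgue_subcube_fin (measurable_eball r) (@eball_cube r). Qed.

Lemma lebesgue_hyperplane (i : 'I_d) (c : R) :
  lam [set x : V | x i ord0 = c] = 0%E.
Proof.
pose A (j : 'I_d) : set R := if j == i then [set c] else setT.
rewrite (_ : [set x | _] = [set x : V | forall j, A j (x j ord0)]).
  rewrite lebesgue_cV_box => [|j]; last by rewrite /A; case: eqP.
  rewrite (bigD1 i)//= /A eqxx.
  by rewrite [X in (X * _)%E](lebesgue_measure_set1 c) mul0e.
apply/seteqP; split=> x /=.
  by rewrite /A => xi j; case: eqP => // ->.
by move=> /(_ i); rewrite /A eqxx.
Qed.

End norm.

(** * Polar coordinates *)

Lemma measurable_inv (R : realType) : measurable_fun setT (@GRing.inv R).
Proof.
rewrite -(setUv [set 0 : R]).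
apply/measurable_funU => //; first exact: measurableC.
split; first exact: measurable_fun_set1.
have o : open (~` [set 0 : R]) by apply: closed_openC; exact: closed_eq.
apply: open_continuous_measurable_fun => //; apply/in_setP => x /= /eqP x0.
exact: inv_continuous.
Qed.

(** Lower rays are stable under intersection and pull back to balls under the norm, so measures in
    the radius are compared on them. They also reduce the continuity of translations to
    half-spaces. *)
Lemma lower_ray_generates (R : realType) :
  (@measurable _ R) = <<s [set A : set R | exists x, A = `]-oo, x]%classic] >>.
Proof.
apply/seteqP; split => [A mA|].
  have : (@RGenOInfty.G R).-sigma.-measurable A by rewrite -RGenOInfty.measurableE.
  apply: smallest_sub; first exact: smallest_sigma_algebra.
  move=> _ [x ->]; rewrite -setCitvl; apply: sigma_algebraC.
  by apply: sub_sigma_algebra; exists x.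
apply: smallest_sub; first exact: sigma_algebra_measurable.
by move=> _ [x ->]; exact: measurable_itv.
Qed.

Section polar.
Context {R : realType} {d : nat} (d_gt0 : (0 < d)%N).
Notation lam := (lebesgue_cV R d).
Notation V := ('cV[R]_d).
Variable sig : probability V R.
Hypothesis sigE : same_law sig uniform_sphere.

Let b1 := lam (eball 1).

Lemma uniform_sphereE A : measurable A -> sig A = (lam (cone A) * (fine b1)^-1%:E)%E.
Proof. exact: sigE. Qed.

(** If this number were 0, its inverse would be 0 by convention, and the total mass of [sig] would
    be 0 instead of 1. *)
Lemma unit_ball_neq0 : fine b1 != 0.
Proof.
apply/eqP => b0; have := uniform_sphereE measurableT.
by rewrite b0 invr0 mule0 probability_setT => /eqP; rewrite onee_eq0.
Qed.

Lemma unit_ball_gt0 : (0 < b1)%E.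
Proof.
rewrite lt_neqAle measure_ge0 andbT eq_sym.
by apply: contra_neq unit_ball_neq0 => ->.
Qed.

(** A cone only tests normalized vectors, and these have norm 1; hence the cone over the complement
    of the sphere is empty. *)
Lemma uniform_sphere_enorm : {ae sig, forall u, enorm u = 1}.
Proof.
exists (~` [set u | enorm u = 1]); split => //.
- apply: measurableC; rewrite (_ : [set u | _] = enorm @^-1` [set 1])//.
  by apply: measurable_preimageT => //; exact: measurable_enorm.
- rewrite uniform_sphereE; last first.
    apply: measurableC; rewrite (_ : [set u | _] = enorm @^-1` [set 1])//.
    by apply: measurable_preimageT => //; exact: measurable_enorm.
  rewrite (_ : cone _ = set0) ?measure0 ?mul0e//.
  apply/seteqP; split => // x [/andP[x0 _]] /=; apply.
  by rewrite enormZ ger0_norm ?invr_ge0 ?(ltW x0)// mulVf// gt_eqF.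
Qed.

Definition direction (x : V) : V := (enorm x)^-1 *: x.

Lemma measurable_direction : measurable_fun setT direction.
Proof.
apply: measurable_cVZ => //; apply: measurableT_comp => //.
  exact: measurable_inv.
exact: measurable_enorm.
Qed.

Lemma enorm_direction x : enorm x *: direction x = x.
Proof.
have [->|x0] := eqVneq x 0; first by rewrite /direction !scaler0.
by rewrite scalerA divff ?scale1r// enorm_eq0.
Qed.

(** For [b = 1] this unfolds to [cone A], so cones inherit the measurability of sectors. *)
Let sector A (b : R) : set V := [set x | 0 < enorm x <= b] `&` direction @^-1` A.

Lemma measurable_sector A b : measurable A -> measurable (sector A b).
Proof.
move=> mA; apply: measurableI; last first.
  by apply: measurable_preimageT => //; exact: measurable_direction.
rewrite (_ : [set x | _] = enorm @^-1` `]0, b]%classic).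
  by apply: measurable_preimageT => //; exact: measurable_enorm.
by apply/seteqP; split => x /=; rewrite in_itv.
Qed.

(** The additivity identity for the dilation by 1/b, applied to [cone A] and the unit ball, reads
    lam (sector) lam (ball 1) = lam (cone) lam (ball b). The scaling factor b^d never has to be
    computed. *)
Lemma lebesgue_sector A b : 0 < b -> measurable A ->
  lam (sector A b) = (lam (eball b) * sig A)%E.
Proof.
move=> b0 mA.
have bV : 0 < b^-1 by rewrite invr_gt0.
have eq1 : (lam (sector A b) * b1 = lam (cone A) * lam (eball b))%E.
  have := @lebesgue_cV_additive R d (fun x => b^-1 *: x) (fun x => b *: x)
    (cone A) (eball 1).
  have -> : (fun x : V => b^-1 *: x) @^-1` cone A = sector A b.
    apply/seteqP; split => x /=; rewrite /cone /sector/= enormZ (gtr0_norm bV).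
      rewrite pmulr_rgt0// ler_pdivrMl// mulr1 => -[? Ax]; split => //.
      move: Ax; congr (A _); rewrite scalerA /direction; congr (_ *: _).
      by rewrite invfM invrK mulrAC mulfV ?mul1r// gt_eqF.
    rewrite pmulr_rgt0// ler_pdivrMl// mulr1 => -[? Ax]; split => //.
    move: Ax; congr (A _); rewrite scalerA /direction; congr (_ *: _).
    by rewrite invfM invrK mulrAC mulfV ?mul1r// gt_eqF.
  have -> : (fun x : V => - (b^-1 *: x)) @^-1` eball 1 = eball b.
    apply/seteqP; split => x /=; rewrite /eball/= enormN enormZ (gtr0_norm bV).
      by rewrite ler_pdivrMl// mulr1.
    by rewrite ler_pdivrMl// mulr1.
  apply.
  - by move=> x y; rewrite scalerDr.
  - by move=> x; rewrite scalerA mulVf ?scale1r// gt_eqF.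
  - exact: measurable_cVZ.
  - exact: measurable_cVZ.
  - exact: (measurable_sector 1 mA).
  - exact: measurable_eball.
have fb1 : b1 = (fine b1)%:E.
  by rewrite fineK// ge0_fin_numE ?measure_ge0//; exact: lebesgue_eball_fin.
rewrite uniform_sphereE// [RHS]muleA [X in (X * _)%E]muleC -eq1 {1}fb1.
by rewrite -muleA -EFinM divff ?unit_ball_neq0// mule1.
Qed.

(** This measure takes the place of c r^(d-1) dr in the usual polar coordinates. *)
Definition norm_law : set R -> \bar R := pushforward lam enorm.

Let m_enorm : measurable_fun setT (@enorm R d).
Proof. exact: measurable_enorm. Qed.

HB.instance Definition _ := Measure.copy norm_law (pushforward_measure lam m_enorm).

Let norm_law_sigma_finite : sigma_finite setT norm_law.
Proof.
exists (fun n => `]-oo, n%:R]%classic) => [|n].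
  apply/seteqP; split => // x _.
  exists (Num.truncn `|x|).+1 => //=; rewrite in_itv/=.
  by rewrite (le_trans (ler_norm _))// ltW// truncnS_gt.
split => //; apply: le_lt_trans (@lebesgue_eball_fin R d n%:R).
rewrite /norm_law /pushforward; apply: le_measure; rewrite ?inE//.
- exact: measurable_preimageT.
- exact: measurable_eball.
Qed.

HB.instance Definition _ := Measure_isSigmaFinite.Build _ _ _ norm_law
  norm_law_sigma_finite.

Lemma measurable_set0v : measurable [set 0 : V].
Proof.
rewrite (_ : [set 0] = enorm @^-1` [set 0]); first exact: measurable_preimageT.
apply/seteqP; split => x /= => [->|/eqP]; first by apply/eqP; rewrite enorm_eq0.
by rewrite enorm_eq0 => /eqP.
Qed.

(** The origin lies in a coordinate hyperplane, which exists because [d] is positive; in dimension 0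
    the measure is the point mass at the origin. *)
Lemma lebesgue0 : lam [set 0] = 0%E.
Proof.
apply/eqP; rewrite eq_le measure_ge0 andbT.
rewrite -(lebesgue_hyperplane (Ordinal d_gt0) 0); apply: le_measure.
- by rewrite inE; exact: measurable_set0v.
- rewrite inE -[[set x | _]]/((fun x : V => x (Ordinal d_gt0) ord0) @^-1` [set 0]).
  by apply: measurable_preimageT => //; exact: measurable_coord.
- by move=> x /= ->; rewrite mxE.
Qed.

(** For fixed [A] both sides are measures in [B]. On a lower ray the identity is the volume formula
    for sectors, and the rays with integer endpoints exhaust the line with finite mass. *)
Lemma lebesgue_norm_direction (B : set R) A : measurable B -> measurable A ->
  lam (enorm @^-1` B `&` direction @^-1` A) = (norm_law B * sig A)%E.
Proof.
move=> mB mA.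
have mE : measurable (direction @^-1` A).
  exact: measurable_preimageT measurable_direction mA.
have sA0 : 0 <= fine (sig A) by exact: fine_ge0.
have fs : sig A = (fine (sig A))%:E by rewrite fineK// fin_num_measure.
pose m1 := pushforward_measure (mrestr lam mE) m_enorm.
pose m2 := mscale (NngNum sA0) norm_law.
rewrite muleC fs -[LHS]/(m1 B) -[RHS]/(m2 B).
apply: (measure_unique _ (fun n => `]-oo, n%:R]%classic : set R)
  (lower_ray_generates R) _ _ _ m1 m2) => //.
- move=> _ _ [x ->] [y ->]; exists (Num.min x y).
  by apply/seteqP; split => z /=; rewrite !in_itv/= le_min => /andP.
- by move=> n; exists n%:R.
- apply/seteqP; split => // x _.
  exists (Num.truncn `|x|).+1 => //=; rewrite in_itv/=.
  by rewrite (le_trans (ler_norm _))// ltW// truncnS_gt.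
- move=> _ [b ->]; rewrite /m1 /m2 /= /mscale /= -fs /norm_law /pushforward /mrestr.
  have -> : enorm @^-1` `]-oo, b]%classic = eball b :> set V.
    by apply/seteqP; split => x /=; rewrite in_itv.
  have [b0|b0] := leP b 0.
    have b_null : lam (eball b) = 0%E.
      apply/eqP; rewrite eq_le measure_ge0 andbT -lebesgue0; apply: le_measure.
      + by rewrite inE; exact: measurable_eball.
      + by rewrite inE; exact: measurable_set0v.
      + move=> x xb; apply/eqP; rewrite -enorm_eq0 eq_le enorm_ge0 andbT.
        exact: le_trans xb b0.
    rewrite b_null mule0; apply: (subset_measure0 _ _ _ b_null) => //.
    + by apply: measurableI => //; exact: measurable_eball.
    + exact: measurable_eball.
  rewrite muleC -lebesgue_sector//.
  (* A sector omits the origin, whereas the ball may contribute it; adjoining this null point to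
     both sets makes them equal. *)
  rewrite -(measureU0 (measurable_sector b mA) measurable_set0v lebesgue0).
  rewrite -(measureU0 (measurableI _ _ (measurable_eball b) mE)
    measurable_set0v lebesgue0).
  congr (lam _); apply/seteqP; split => x /= [|->]; try by right.
    have [->|x0] := eqVneq x 0; first by right.
    by move=> [xb Ax]; left; split => //=; rewrite xb lt_neqAle eq_sym enorm_eq0 x0 enorm_ge0.
  by move=> [/= /andP[x0 xb] Ax]; left.
- move=> n; rewrite /m1 /= /pushforward /mrestr.
  apply: le_lt_trans (@lebesgue_eball_fin R d n%:R); apply: le_measure.
  + by rewrite inE; apply: measurableI => //; exact: measurable_preimageT.
  + by rewrite inE; exact: measurable_eball.
  + by move=> x [/=]; rewrite in_itv.
Qed.

(** The inner integral depends on x through its norm only, so x may be replaced by a radius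
    distributed as [norm_law]. The product of [norm_law] and [sig] is the image of Lebesgue measure
    under x -> (enorm x, direction x), and multiplying the two components gives x back. *)
Lemma polar_integral (f : V -> \bar R) : measurable_fun setT f ->
  (forall x, 0 <= f x)%E ->
  (\int[lam]_x \int[sig]_u f (enorm x *: u)%R = \int[lam]_x f x)%E.
Proof.
move=> mf f0.
have mND : measurable_fun setT (fun x : V => (enorm x, direction x)).
  by apply/measurable_fun_pair => //; exact: measurable_direction.
pose F (z : R * V) := f (z.1 *: z.2).
have mF : measurable_fun setT F.
  apply: (measurableT_comp mf).
  by apply: measurable_cVZ; [exact: measurable_fst|exact: measurable_snd].
have F0 z : (0 <= F z)%E by exact: f0.
transitivity (\int[norm_law]_r \int[sig]_u F (r, u))%E.
  rewrite (ge0_integral_pushforward m_enorm)//=.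
  - exact: (measurable_fun_fubini_tonelli_F F).
  - by move=> r _; apply: integral_ge0 => u _; exact: F0.
rewrite -(fubini_tonelli1 F)//.
rewrite (eq_measure_integral (pushforward_measure lam mND)); last first.
  move=> E mE _; apply: product_measure_unique => // B A mB mA.
  exact: lebesgue_norm_direction.
rewrite (ge0_integral_pushforward mND)//= preimage_setT.
by apply: eq_integral => x _; rewrite /F /= enorm_direction.
Qed.

End polar.

(** * Densities and spherical averages *)

Section density.
Local Open Scope ereal_scope.
Context d (T : measurableType d) (R : realType).
Variables (mu nu : {measure set T -> \bar R}) (p : T -> R).
Hypotheses (mp : measurable_fun setT p) (p0 : forall x, (0 <= p x)%R).
Hypothesis nuE : forall A, measurable A -> nu A = \int[mu]_(x in A) (p x)%:E.

Let measurable_density : measurable_fun setT (EFin \o p).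
Proof. exact/measurable_EFinP. Qed.

Import HBNNSimple.

Let integral_density_nnsfun (g : {nnsfun T >-> R}) :
  \int[nu]_x (g x)%:E = \int[mu]_x ((g x)%:E * (p x)%:E).
Proof.
have mind (r : R) : measurable_fun setT
    (fun x => (\1_(g @^-1` [set r]) x)%:E * (p x)%:E).
  by apply: emeasurable_funM => //; exact/measurable_EFinP.
rewrite integralT_nnsfun sintegralE.
under [RHS]eq_integral.
  move=> x _; rewrite fimfunE -fsumEFin// ge0_mule_fsuml; last first.
    by move=> r; rewrite EFinM nnfun_muleindic_ge0.
  over.
rewrite [RHS]ge0_integral_fsum//; last 2 first.
- move=> r; apply: emeasurable_funM => //; apply/measurable_EFinP.
  exact: measurable_funM.
- by move=> r x _; rewrite mule_ge0 ?lee_fin// -lee_fin EFinM nnfun_muleindic_ge0.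
apply: eq_fsbigr => r; rewrite inE => -[x _ gxr].
under eq_integral do rewrite EFinM -muleA.
rewrite ge0_integralZl//; last 2 first.
- by move=> y _; rewrite mule_ge0// lee_fin.
- by rewrite lee_fin -gxr.
congr (_ * _); rewrite nuE// integral_mkcond.
apply: eq_integral => y _; rewrite patchE indicE; case: ifPn => _.
  by rewrite mul1e.
by rewrite mul0e.
Qed.

Lemma ge0_integral_density (f : T -> \bar R) :
  measurable_fun setT f -> (forall x, 0 <= f x) ->
  \int[nu]_x f x = \int[mu]_x (f x * (p x)%:E).
Proof.
move=> mf f0; pose f_ := nnsfun_approx measurableT mf.
have cvg_f x : (f_ n x)%:E @[n --> \oo] --> f x.
  exact: cvg_nnsfun_approx.
have nd_f x : {homo (fun n => (f_ n x)%:E) : m n / (m <= n)%N >-> m <= n}.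
  by move=> m n mn; rewrite lee_fin; exact/lefP/nd_nnsfun_approx.
transitivity (limn (fun n => \int[nu]_x (f_ n x)%:E)).
  rewrite -monotone_convergence//.
  - by apply: eq_integral => x _; apply/esym/cvg_lim.
  - by move=> n; exact/measurable_EFinP.
  - by move=> n x _; rewrite lee_fin.
under eq_fun do rewrite integral_density_nnsfun.
rewrite -monotone_convergence//.
- by apply: eq_integral => x _; apply/cvg_lim => //; exact: cvgeZr.
- by move=> n; apply: emeasurable_funM => //; exact/measurable_EFinP.
- by move=> n x _; rewrite mule_ge0// lee_fin.
- by move=> x _ m n mn; rewrite lee_wpmul2r ?lee_fin ?p0// -lee_fin nd_f.
Qed.

End density.

(** * Averaging over spheres as a symmetric projection *)

Section average.
Context {R : realType} {d : nat} (d_gt0 : (0 < d)%N).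
Notation lam := (lebesgue_cV R d).
Notation V := ('cV[R]_d).
Variable sig : probability V R.
Hypothesis sigE : same_law sig uniform_sphere.
Local Open Scope ereal_scope.
Implicit Types f g : V -> \bar R.

Definition average f (x : V) := \int[sig]_u f (enorm x *: u)%R.

Lemma measurable_rescale :
  measurable_fun setT (fun z : V * V => (enorm z.1 *: z.2)%R).
Proof.
apply: measurable_cVZ; last exact: measurable_snd.
by apply: measurable_enorm; exact: measurable_fst.
Qed.

Lemma measurable_rescalel (x : V) : measurable_fun setT (fun u : V => (enorm x *: u)%R).
Proof. exact: measurable_cVZ. Qed.

Lemma measurable_average f : measurable_fun setT f -> (forall x, 0 <= f x) ->
  measurable_fun setT (average f).
Proof.
move=> mf f0.
apply: (measurable_fun_fubini_tonelli_F (fun z : V * V => f (enorm z.1 *: z.2)%R)) => //.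
exact: (measurableT_comp mf measurable_rescale).
Qed.

Lemma average_ge0 f x : (forall x, 0 <= f x) -> 0 <= average f x.
Proof. by move=> f0; apply: integral_ge0. Qed.

(** For [sig]-almost every u the norm of u is 1, so [g] equals g x all along the sphere through x
    and leaves the integral. *)
Lemma average_radial f g x : measurable_fun setT f -> (forall x, 0 <= f x) ->
  measurable_fun setT g -> (forall x, 0 <= g x) ->
  (forall x y, enorm x = enorm y -> g x = g y) ->
  average (f \* g) x = average f x * g x.
Proof.
move=> mf f0 mg g0 grad; rewrite /average.
have mF := measurableT_comp mf (measurable_rescalel x).
have mG := measurableT_comp mg (measurable_rescalel x).
rewrite muleC -ge0_integralZl//.
apply: ge0_ae_eq_integral => //.
- exact: emeasurable_funM.
- exact: measurable_funeM.
- by move=> u _; rewrite mule_ge0.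
- by move=> u _; rewrite mule_ge0.
apply: filterS (uniform_sphere_enorm sigE) => u u1 _ /=.
rewrite muleC; congr (_ * _); apply: grad.
by rewrite enormZ u1 mulr1 ger0_norm// enorm_ge0.
Qed.

Lemma integral_average f : measurable_fun setT f -> (forall x, 0 <= f x) ->
  \int[lam]_x average f x = \int[lam]_x f x.
Proof. exact: polar_integral. Qed.

(** As [average g] is radial, averaging f times [average g] only affects f, and averaging preserves
    integrals. The identity contains both symmetry and idempotence. *)
Lemma integral_mul_average f g : measurable_fun setT f -> (forall x, 0 <= f x) ->
  measurable_fun setT g -> (forall x, 0 <= g x) ->
  \int[lam]_x (f x * average g x) = \int[lam]_x (average f x * average g x).
Proof.
move=> mf f0 mg g0; have mA := measurable_average mg g0.
rewrite -(integral_average (f := f \* average g)).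
- apply: eq_integral => x _; apply: average_radial => //.
  + by move=> y; exact: average_ge0.
  + by move=> y z yz; rewrite /average yz.
- exact: emeasurable_funM.
- by move=> x; rewrite mule_ge0// average_ge0.
Qed.

Lemma integral_averageC f g : measurable_fun setT f -> (forall x, 0 <= f x) ->
  measurable_fun setT g -> (forall x, 0 <= g x) ->
  \int[lam]_x (f x * average g x) = \int[lam]_x (average f x * g x).
Proof.
move=> mf f0 mg g0; rewrite integral_mul_average//.
under eq_integral do rewrite muleC.
by rewrite -integral_mul_average//; apply: eq_integral => x _; rewrite muleC.
Qed.

End average.

(** * Continuity of translations *)

(** Continuity from above in the form in which an index is chosen: it serves remainders of countable
    unions, slabs closing in on a hyperplane, and complements of growing cubes. *)
Lemma nonincreasing_null_small d (T : measurableType d) (R : realType)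
    (mu : {measure set T -> \bar R}) (F : (set T)^nat) (e : R) :
  (forall n, measurable (F n)) -> (mu (F 0%N) < +oo)%E -> nonincreasing_seq F ->
  mu (\bigcap_n F n) = 0%E -> 0 < e -> exists n, (mu (F n) <= e%:E)%E.
Proof.
move=> mF F0 niF F_null e0.
have mI : measurable (\bigcap_n F n) by exact: bigcapT_measurable.
have := nonincreasing_cvg_mu F0 mF mI niF; rewrite F_null => Fcvg.
have e0' : (0 < e%:E)%E by rewrite lte_fin.
have [n _ /(_ n (leqnn n)) /= Fn] := Fcvg _ (open_ereal_lt' e0').
by exists n; exact: ltW.
Qed.

Lemma le_measure3 d (T : measurableType d) (R : realType)
    (mu : {measure set T -> \bar R}) (A B C D : set T) :
  measurable A -> measurable B -> measurable C -> measurable D ->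
  A `<=` B `|` C `|` D -> (mu A <= mu B + mu C + mu D)%E.
Proof.
move=> mA mB mC mD ABCD.
apply: (@le_trans _ _ (mu (B `|` C `|` D))).
  by apply: le_measure => //; rewrite inE//; do ![apply: measurableU => //].
apply: le_trans (measureU2 _ _ _) _ => //; first exact: measurableU.
by rewrite leeD2r// measureU2.
Qed.

Section translation_continuity.
Context {R : realType} {d : nat}.
Notation lam := (lebesgue_cV R d).
Notation V := ('cV[R]_d).
Implicit Types (z : V) (C D : set V).

Definition translate z C : set V := (fun x => x + z) @^-1` C.

Lemma measurable_translate z C : measurable C -> measurable (translate z C).
Proof. by move=> mC; apply: measurable_preimageT => //; exact: measurable_cVD. Qed.

Definition moved z C : set V := (C `\` translate z C) `|` (translate z C `\` C).

Lemma measurable_moved z C : measurable C -> measurable (moved z C).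
Proof.
by move=> mC; apply: measurableU; apply: measurableD => //; exact: measurable_translate.
Qed.

(** The bound is local because a half-space and its translate can differ by a slab of infinite
    volume. In this form the property passes to complements, so that the sets having it are a
    sigma-algebra. *)
Definition translation_continuous C := measurable C /\
  forall r e : R, 0 < e -> exists2 del : R, 0 < del &
    forall z, centered_cube del z -> (lam (moved z C `&` centered_cube r) <= e%:E)%E.

Lemma moved_setC z C : moved z (~` C) = moved z C.
Proof.
apply/seteqP; split => x; rewrite /moved /translate /= => -[[a b]|[a b]].
- by right; split => //; exact: contrapT.
- by left; split => //; exact: contrapT.
- by right; split => // /(_ a).
- by left; split => // /(_ a).
Qed.

Lemma moved_setU z C D : moved z (C `|` D) `<=` moved z C `|` moved z D.
Proof.
move=> x; rewrite /moved /translate /= => -[[[a|a] b]|[[a|a] b]].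
- by left; left; split => // c; apply: b; left.
- by right; left; split => // c; apply: b; right.
- by left; right; split => // c; apply: b; left.
- by right; right; split => // c; apply: b; right.
Qed.

Lemma translation_continuous0 : translation_continuous set0.
Proof.
split=> // r e e0; exists 1 => // z _.
rewrite (_ : moved z set0 = set0) ?set0I ?measure0 ?lee_fin ?ltW//.
by apply/seteqP; split => x //; rewrite /moved /translate /= => -[[]|[]].
Qed.

Lemma translation_continuousC C :
  translation_continuous C -> translation_continuous (~` C).
Proof.
move=> [mC cC]; split=> [|r e e0]; first exact: measurableC.
have [del del0 H] := cC r e e0; exists del => // z /H.
by rewrite moved_setC.
Qed.

Lemma centered_cube_min (a b : R) z :
  centered_cube (Num.min a b) z -> centered_cube a z /\ centered_cube b z.
Proof. by move=> zab; split => i; have := zab i; rewrite le_min => /andP[]. Qed.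

Lemma translation_continuousU C D : translation_continuous C ->
  translation_continuous D -> translation_continuous (C `|` D).
Proof.
move=> [mC cC] [mD cD]; split=> [|r e e0]; first exact: measurableU.
have e20 : 0 < e / 2 by rewrite divr_gt0.
have [a a0 Ha] := cC r _ e20; have [b b0 Hb] := cD r _ e20.
exists (Num.min a b); first by rewrite lt_min a0 b0.
move=> z /centered_cube_min[/Ha {}Ha /Hb {}Hb].
have m1 := measurableI _ _ (measurable_moved z mC) (measurable_cube r).
have m2 := measurableI _ _ (measurable_moved z mD) (measurable_cube r).
have m3 := measurableI _ _ (measurable_moved z (measurableU _ _ mC mD)) (measurable_cube r).
have := le_measure3 lam m3 m1 m2 measurable0.
rewrite (_ : e%:E = (e / 2)%:E + (e / 2)%:E)%E; last by rewrite -EFinD -splitr.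
move=> H; apply: le_trans (H _) _; last by rewrite measure0 adde0 leeD.
by move=> x [/moved_setU[|] xm xr]; left; [left|right].
Qed.

(** A finite subunion [G n] misses little of the union inside a slightly larger cube. A point moved
    by the union is then moved by [G n], or it lies in the remainder, or its translate does; each
    case costs e/3. *)
Lemma translation_continuous_bigcup (F : (set V)^nat) :
  (forall n, translation_continuous (F n)) ->
  translation_continuous (\bigcup_n F n).
Proof.
move=> cF; have mF n : measurable (F n) by case: (cF n).
have mUF : measurable (\bigcup_n F n) by exact: bigcupT_measurable.
split => // r e e0.
pose G n := \big[setU/set0]_(k < n) F k.
have cG n : translation_continuous (G n).
  rewrite /G; elim/big_ind : _ => //; first exact: translation_continuous0.
  by move=> ? ? ? ?; exact: translation_continuousU.
have mG n : measurable (G n) by case: (cG n).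
(* The margin 1 matches the bound 1 imposed on the coordinates of [z] below: x + z stays in this
   cube when x is in the cube of size [r]. *)
pose E n := (\bigcup_n F n `\` G n) `&` centered_cube (r + 1).
have mE n : measurable (E n).
  by apply: measurableI; [exact: measurableD|exact: measurable_cube].
have e30 : 0 < e / 3 by rewrite divr_gt0.
have [n En] : exists n, (lam (E n) <= (e / 3)%:E)%E.
  apply: nonincreasing_null_small => //.
  - by apply: (lebesgue_subcube_fin (r := r + 1)) => // x [].
  - move=> m n mn; apply/subsetPset => x [[Fx Gx] xr]; split => //; split => //.
    by apply: contra_not Gx; apply: subset_bigsetU.
  - rewrite (_ : \bigcap_n E n = set0) ?measure0//.
    apply/seteqP; split => // x EE.
    have [[[k _ Fkx] _] _] := EE 0%N Logic.I.
    have [[_ +] _] := EE k.+1 Logic.I; apply.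
    by rewrite /G big_ord_recr/=; right.
have [_ /(_ r _ e30)[a a0 Ha]] := cG n.
exists (Num.min a 1); first by rewrite lt_min a0 ltr01.
move=> z /centered_cube_min[/Ha {}Ha z1].
have m1 := measurableI _ _ (measurable_moved z (mG n)) (measurable_cube r).
have m2 := measurableI _ _ (measurable_moved z mUF) (measurable_cube r).
have m3 := measurable_translate z (mE n).
have H := le_measure3 lam m2 m1 (mE n) m3.
rewrite (_ : e%:E = (e / 3)%:E + (e / 3)%:E + (e / 3)%:E)%E; last first.
  by rewrite -!EFinD; congr _%:E; lra.
apply: le_trans (H _) _; last first.
  by rewrite !leeD// [leLHS](lebesgue_cV_translate z (mE n)).
have GF x : G n x -> (\bigcup_n F n) x.
  by rewrite /G -bigcup_mkord => -[k _ ?]; exists k.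
have xr1 (x : V) : centered_cube r x -> centered_cube (r + 1) x.
  by move=> xr i; rewrite (le_trans (xr i))// lerDl ler01.
have xzr1 (x : V) : centered_cube r x -> centered_cube (r + 1) (x + z).
  move=> xr i; rewrite mxE; apply: le_trans (ler_normD _ _) _.
  by apply: lerD; [exact: xr|exact: z1].
move=> x [[[Fx nFxz]|[Fxz nFx]] xr]; rewrite /moved /translate /=.
  have [Gx|Gx] := pselect (G n x).
    by left; left; split => //; left; split => //; apply: contra_not nFxz => /GF.
  by left; right; split => //; exact: xr1.
have [Gx|Gx] := pselect (G n (x + z)).
  by left; left; split => //; right; split => //; apply: contra_not nFx => /GF.
by right; split; [split|exact: xzr1].
Qed.

(** A point changing sides under a small translation lies in a thin slab around the hyperplane x_i =
    c, and inside a cube these slabs decrease to a null set. *)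
Lemma translation_continuous_ray (i : 'I_d) (c : R) :
  translation_continuous ((fun x : V => x i ord0) @^-1` `]-oo, c]%classic).
Proof.
have mi : measurable_fun setT (fun x : V => x i ord0) by exact: measurable_coord.
split=> [|r e e0]; first exact: measurable_preimageT.
pose F n := (fun x : V => x i ord0) @^-1` `[c - n.+1%:R^-1, c + n.+1%:R^-1]%classic
  `&` centered_cube r.
have mF n : measurable (F n).
  by apply: measurableI; [exact: measurable_preimageT|exact: measurable_cube].
have [n Fn] : exists n, (lam (F n) <= e%:E)%E.
  apply: nonincreasing_null_small => //.
  - by apply: (lebesgue_subcube_fin (r := r)) => // x [].
  - move=> m n mn; apply/subsetPset => x [/=]; rewrite !in_itv/= => /andP[x1 x2] xr.
    have mn' : n.+1%:R^-1 <= m.+1%:R^-1 :> R by rewrite lef_pV2 ?posrE// ler_nat ltnS.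
    split => //=; rewrite in_itv/=; apply/andP; split.
      by apply: le_trans x1; rewrite lerD2l lerN2.
    by apply: (le_trans x2); rewrite lerD2l.
  - apply/eqP; rewrite eq_le measure_ge0 andbT -(lebesgue_hyperplane i c).
    apply: le_measure.
    + by rewrite inE; exact: bigcapT_measurable.
    + rewrite inE -[[set x | _]]/((fun x : V => x i ord0) @^-1` [set c]).
      exact: measurable_preimageT.
    + move=> x Fx; apply/eqP; rewrite -subr_eq0 -normr_le0.
      apply/ler_addgt0Pr => t t0; rewrite add0r.
      have [n _ /(_ n (leqnn n)) /= nt] := near_infty_natSinv_lt (PosNum t0).
      apply: le_trans (ltW nt); have [/= + _] := Fx n Logic.I.
      by rewrite in_itv/= ler_distl.
exists n.+1%:R^-1 => // z zn; apply: le_trans Fn; apply: le_measure.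
- rewrite inE; apply: measurableI; last exact: measurable_cube.
  by apply: measurable_moved; exact: measurable_preimageT.
- by rewrite inE.
- move=> x [+ xr]; rewrite /moved /translate /= !in_itv/= mxE => H.
  split => //=; rewrite in_itv/=.
  have := zn i; rewrite ler_norml => /andP[].
  move: (x i ord0) (z i ord0) (n.+1%:R^-1) H => u v w H z1 z2.
  by case: H => -[a /negP]; rewrite -ltNge => b; apply/andP; split; lra.
Qed.

(** Generation is used twice: the Borel sets of R^d come from coordinate preimages, and the Borel
    sets of the line from lower rays. *)
Lemma measurable_translation_continuous C : measurable C -> translation_continuous C.
Proof.
move: C; apply: smallest_sub.
  split=> [|A cA|F cF].
  - exact: translation_continuous0.
  - by rewrite setTD; exact: translation_continuousC.
  - exact: translation_continuous_bigcup.
rewrite -bigcup_seq; apply: bigcup_sub => i _ _ [B mB <-] /=; rewrite setTI.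
suff : (@measurable _ R) `<=`
    [set B | translation_continuous ((fun x : V => x i ord0) @^-1` B)] by exact.
rewrite lower_ray_generates; apply: smallest_sub.
  split=> [|A /= cA|F /= cF] /=.
  - by rewrite preimage_set0; exact: translation_continuous0.
  - by rewrite setTD preimage_setC; exact: translation_continuousC.
  - by rewrite preimage_bigcup; exact: translation_continuous_bigcup.
by move=> _ [c ->]; exact: translation_continuous_ray.
Qed.

(** Finite measure makes the part of [C] outside a large cube negligible, which removes the
    restriction to cubes. *)
Lemma lebesgue_meet_translate C (e : R) : measurable C -> (lam C < +oo)%E -> 0 < e ->
  exists2 del : R, 0 < del & forall z, centered_cube del z ->
    (lam C <= lam (C `&` translate z C) + e%:E)%E.
Proof.
move=> mC Coo e0; have e20 : 0 < e / 2 by rewrite divr_gt0.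
pose F n := C `\` centered_cube n%:R.
have mF n : measurable (F n) by apply: measurableD => //; exact: measurable_cube.
have [n Fn] : exists n, (lam (F n) <= (e / 2)%:E)%E.
  apply: nonincreasing_null_small => //.
  - by apply: le_lt_trans Coo; apply: le_measure; rewrite ?inE//; exact: subIsetl.
  - move=> m n mn; apply/subsetPset => x [Cx xn]; split => //.
    apply: contra_not xn => xm i; apply: le_trans (xm i) _; by rewrite ler_nat.
  - rewrite (_ : \bigcap_n F n = set0) ?measure0//; apply/seteqP; split => // x Fx.
    have [_ +] := Fx (Num.truncn (enorm x)).+1 Logic.I; apply => i.
    by rewrite (le_trans (ler_coord_enorm _ _))// ltW// truncnS_gt.
have [_ /(_ n%:R _ e20)[del del0 H]] := measurable_translation_continuous mC.
exists del => // z /H {}H.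
have m1 := measurableI _ _ mC (measurable_translate z mC).
have m2 := measurableI _ _ (measurable_moved z mC) (measurable_cube n%:R).
apply: le_trans (le_measure3 lam mC m1 (mF n) m2 _ : (lam _ <= _)%E) _; last first.
  rewrite (_ : e%:E = (e / 2)%:E + (e / 2)%:E)%E; last by rewrite -EFinD -splitr.
  by rewrite -addeA leeD2l// leeD.
move=> x Cx.
have [xn|xn] := pselect (centered_cube n%:R x); last by left; right.
have [xz|xz] := pselect (C (x + z)); first by left; left.
by right; split => //; left.
Qed.

End translation_continuity.

(** * Lower bound for the autocorrelation near the origin *)

Section autocorrelation.
Context {R : realType} {d : nat}.
Notation lam := (lebesgue_cV R d).
Notation V := ('cV[R]_d).
Import HBNNSimple.

(** The value 0 is exempt from finiteness: its level set usually has infinite volume, but 0 times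
    infinity is 0 here. *)
Lemma sum_measure_meet_translate (C : R -> set V) (s : seq R) (e : R) :
  (forall a, measurable (C a)) ->
  (forall a, a \in s -> a != 0 -> (lam (C a) < +oo)%E) -> 0 < e ->
  exists2 del : R, 0 < del & forall z, centered_cube del z ->
    (\sum_(a <- s) (a ^+ 2)%:E * lam (C a) <=
     \sum_(a <- s) (a ^+ 2)%:E * lam (C a `&` translate z (C a)) + e%:E)%E.
Proof.
move=> mC; elim: s e => [|a s IHs] e Cfin e0.
  by exists 1 => // z _; rewrite !big_nil add0e lee_fin ltW.
have e20 : 0 < e / 2 by rewrite divr_gt0.
have [del del0 H] : exists2 del : R, 0 < del & forall z, centered_cube del z ->
    ((a ^+ 2)%:E * lam (C a) <=
     (a ^+ 2)%:E * lam (C a `&` translate z (C a)) + (e / 2)%:E)%E.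
  have [->|a0] := eqVneq a 0.
    by exists 1 => // z _; rewrite expr0n/= !mul0e add0e lee_fin ltW.
  have a20 : 0 < a ^+ 2 by rewrite exprn_even_gt0.
  have [del del0 H] := lebesgue_meet_translate (mC a)
    (Cfin a (mem_head _ _) a0) (divr_gt0 e20 a20).
  exists del => // z /H{}H; apply: le_trans (lee_wpmul2l _ H) _.
    by rewrite lee_fin ltW.
  rewrite ge0_muleDr//; last by rewrite lee_fin divr_ge0// ltW.
  by rewrite -[X in (_ + X <= _)%E]EFinM mulrCA divff ?mulr1// gt_eqF.
have [|del' del'0 H'] := IHs (e / 2) _ e20.
  by move=> b bs; apply: Cfin; rewrite inE bs orbT.
exists (Num.min del del'); first by rewrite lt_min del0 del'0.
move=> z /centered_cube_min[/H{}H /H'{}H'].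
rewrite !big_cons [e]splitr EFinD addeACA.
exact: leeD.
Qed.

(** Expanding g(x) g(x + z) over pairs of level sets and keeping only the diagonal terms leaves a
    lower bound by volumes of level sets met with their translates. Finiteness of the integral of
    g^2 bounds the volume of each level set with nonzero value. *)
Lemma autocorrelation_simple (g : {nnsfun V >-> R}) (e : R) :
  (\int[lam]_x (g x ^+ 2)%:E < +oo)%E -> 0 < e ->
  exists2 del : R, 0 < del & forall z, centered_cube del z ->
    (\int[lam]_x (g x ^+ 2)%:E <= \int[lam]_x (g x * g (x + z)%R)%:E + e%:E)%E.
Proof.
move=> goo e0.
have /finite_seqP[s0 g_s0] : finite_set (range g) by exact: fimfunP.
pose s := undup s0.
have gs x : g x \in s.
  by have : range g (g x) by [exists x]; rewrite g_s0 mem_undup.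
have us : uniq s by exact: undup_uniq.
pose C a := g @^-1` [set a].
have mC a : measurable (C a) by exact: measurable_funPTI.
have int_sum (D : R -> set V) : (forall a, measurable (D a)) ->
    (\int[lam]_x (\sum_(a <- s) a ^+ 2 * \1_(D a) x)%:E =
     \sum_(a <- s) (a ^+ 2)%:E * lam (D a))%E.
  move=> mD; under eq_integral do rewrite -sumEFin.
  rewrite ge0_integral_sum//.
  - apply: eq_bigr => a _; under eq_integral do rewrite EFinM.
    rewrite ge0_integralZl_EFin ?sqr_ge0//.
      by rewrite integral_indic// setIT.
    by apply/measurable_EFinP; exact: measurable_indic.
  - by move=> a; apply/measurable_EFinP; apply: measurable_funM.
  - by move=> a x _; rewrite lee_fin mulr_ge0// sqr_ge0.
have sqE x : g x ^+ 2 = \sum_(a <- s) a ^+ 2 * \1_(C a) x.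
  rewrite (bigD1_seq (g x))//= indicE mem_set// mulr1 big1 ?addr0// => a ax.
  by rewrite indicE memNset ?mulr0// /C /= => xa; rewrite xa eqxx in ax.
have Eg : (\int[lam]_x (g x ^+ 2)%:E = \sum_(a <- s) (a ^+ 2)%:E * lam (C a))%E.
  by rewrite -int_sum//; apply: eq_integral => x _; rewrite sqE.
have Cfin a : a \in s -> a != 0 -> (lam (C a) < +oo)%E.
  move=> as_ a0; move: goo; rewrite Eg (bigD1_seq a)//=.
  rewrite !ltey; apply: contra_neq => ->.
  rewrite gt0_muley ?lte_fin ?exprn_even_gt0// addye// gt_eqF//.
  apply: (@lt_le_trans _ _ 0%E) => //; apply: sume_ge0 => b _.
  by rewrite mule_ge0// lee_fin sqr_ge0.
have [del del0 H] := sum_measure_meet_translate mC Cfin e0.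
exists del => // z /H{}H; rewrite Eg; apply: le_trans H _; rewrite leeD2r//.
have mCz a : measurable (C a `&` translate z (C a)).
  by apply: measurableI => //; exact: measurable_translate.
rewrite -int_sum//.
have mz : measurable_fun setT (fun x : V => g (x + z)).
  by apply: (measurableT_comp (measurable_funP g)); exact: measurable_cVD.
apply: ge0_le_integral => //.
- by move=> x _; rewrite lee_fin; apply: sumr_ge0 => a _; rewrite mulr_ge0// sqr_ge0.
- apply/measurable_EFinP; apply: measurable_sum => a.
  by apply: measurable_funM => //; exact: measurable_indic.
- by apply/measurable_EFinP; exact: measurable_funM.
- move=> x _; rewrite lee_fin (bigD1_seq (g x))//= big1 ?addr0 => [|a ax].
    rewrite indicE; case: (boolP (x \in _)) => [|_]; last by rewrite mulr0 mulr_ge0.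
    by move=> /set_mem[_]; rewrite /translate /C /= => ->; rewrite mulr1.
  by rewrite indicE memNset ?mulr0// /C /= => -[xa _]; rewrite xa eqxx in ax.
Qed.

(** Simple functions g increase to p, so the integral of g^2 comes within e/2 of that of p^2; as 0
    <= g <= p, the autocorrelation of p dominates that of g. *)
Lemma autocorrelation_lower_bound (p : V -> R) (e : R) :
  measurable_fun setT p -> (forall x, 0 <= p x) ->
  (\int[lam]_x (p x ^+ 2)%:E < +oo)%E -> 0 < e ->
  exists2 del : R, 0 < del & forall z, centered_cube del z ->
    (\int[lam]_x (p x ^+ 2)%:E <= \int[lam]_x (p x * p (x + z)%R)%:E + e%:E)%E.
Proof.
move=> mp p0 poo e0; have e20 : 0 < e / 2 by rewrite divr_gt0.
have mpE : measurable_fun setT (EFin \o p) by exact/measurable_EFinP.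
pose g := nnsfun_approx measurableT mpE.
have g_cvg x : (g n x)%:E @[n --> \oo] --> (p x)%:E.
  by apply: (@cvg_nnsfun_approx _ _ _ _ measurableT _ mpE) => // y _; rewrite lee_fin.
have g_nd x : {homo (fun n => g n x) : m n / (m <= n)%N >-> m <= n}.
  by move=> m n mn; exact/lefP/nd_nnsfun_approx.
have gp n x : g n x <= p x.
  rewrite -lee_fin; apply: cvge_ge (g_cvg x); exists n => // m nm /=.
  by rewrite lee_fin g_nd.
have sq_cvg : (\int[lam]_x (g n x ^+ 2)%:E @[n --> \oo] --> \int[lam]_x (p x ^+ 2)%:E)%E.
  rewrite (_ : (\int[lam]_x (p x ^+ 2)%:E)%E =
      (\int[lam]_x limn (fun n => (g n x ^+ 2)%:E))%E).
    apply: cvg_monotone_convergence => //.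
    - by move=> n; apply/measurable_EFinP; exact: measurable_funX.
    - by move=> n x _; rewrite lee_fin sqr_ge0.
    - by move=> x _ m n mn; rewrite lee_fin lerXn2r ?nnegrE// g_nd.
  apply: eq_integral => x _; apply/esym/cvg_lim => //.
  under eq_fun do rewrite expr2 EFinM.
  by rewrite expr2 EFinM; apply: cvgeM.
have [n Hn] : exists n, (\int[lam]_x (p x ^+ 2)%:E <=
    \int[lam]_x (g n x ^+ 2)%:E + (e / 2)%:E)%E.
  have fin : (\int[lam]_x (p x ^+ 2)%:E)%E \is a fin_num.
    by rewrite ge0_fin_numE// integral_ge0// => x _; rewrite lee_fin sqr_ge0.
  have lt : (\int[lam]_x (p x ^+ 2)%:E - (e / 2)%:E < \int[lam]_x (p x ^+ 2)%:E)%E.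
    by rewrite lteBlDr// lteDl// lte_fin.
  have [n _ /(_ n (leqnn n))/= Hn] := sq_cvg _ (open_ereal_gt' lt).
  by exists n; rewrite -leeBlDr// ltW.
have goo : (\int[lam]_x (g n x ^+ 2)%:E < +oo)%E.
  apply: le_lt_trans poo; apply: ge0_le_integral => //.
  - by move=> x _; rewrite lee_fin sqr_ge0.
  - by apply/measurable_EFinP; exact: measurable_funX.
  - by apply/measurable_EFinP; exact: measurable_funX.
  - by move=> x _; rewrite lee_fin lerXn2r ?nnegrE.
have [del del0 H] := autocorrelation_simple goo e20.
exists del => // z /H{}H; apply: le_trans Hn _.
rewrite [e in leRHS]splitr EFinD addeA leeD2r//; apply: le_trans H _; rewrite leeD2r//.
have mz (f : V -> R) : measurable_fun setT f -> measurable_fun setT (fun x : V => f (x + z)).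
  by move=> mf; apply: (measurableT_comp mf); exact: measurable_cVD.
apply: ge0_le_integral => //.
- by move=> x _; rewrite lee_fin mulr_ge0.
- by apply/measurable_EFinP; apply: measurable_funM => //; exact: mz.
- by apply/measurable_EFinP; apply: measurable_funM => //; exact: mz.
- by move=> x _; rewrite lee_fin ler_pM.
Qed.

End autocorrelation.

(** * Comparison of the L^2 norms *)

Section integral_indicator.
Local Open Scope ereal_scope.
Context d (T : measurableType d) (R : realType) (mu : {measure set T -> \bar R}).
Variables (S : set T) (F : T -> \bar R).
Hypotheses (mS : measurable S) (mF : measurable_fun setT F) (F0 : forall z, 0 <= F z).
Implicit Types a e k : \bar R.

Let m1 : measurable_fun setT (fun z => (\1_S z : R)%:E).
Proof. by apply/measurable_EFinP; exact: measurable_indic. Qed.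

Lemma integral_indicZr k : 0 <= k -> \int[mu]_z ((\1_S z)%:E * k) = mu S * k.
Proof.
move=> k0; under eq_integral do rewrite muleC.
by rewrite ge0_integralZl// muleC integral_indic// setIT.
Qed.

Let mk k : measurable_fun setT (fun z => (\1_S z : R)%:E * k).
Proof. by apply: emeasurable_funM => //; exact: measurable_cst. Qed.

Let m1F : measurable_fun setT (fun z => (\1_S z : R)%:E * F z).
Proof. exact: emeasurable_funM. Qed.

(** The error [e] is added on the right so that nothing is subtracted in the extended reals. *)
Lemma le_integral_indic k e : 0 <= k -> 0 <= e ->
  (forall z, S z -> k <= F z + e) ->
  mu S * k <= \int[mu]_z ((\1_S z)%:E * F z) + mu S * e.
Proof.
move=> k0 e0 kF; rewrite -(integral_indicZr k0) -(integral_indicZr e0).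
rewrite -ge0_integralD//; last 2 first.
- by move=> z _; rewrite mule_ge0.
- by move=> z _; rewrite mule_ge0.
apply: ge0_le_integral => //.
- by move=> z _; rewrite mule_ge0.
- exact: emeasurable_funD.
- move=> z _; rewrite indicE.
  have [/set_mem Sz|_] := boolP (z \in S); last by rewrite !mul0e adde0.
  by rewrite !mul1e kF.
Qed.

Lemma integral_indic_le k a : 0 <= k -> 0 <= a -> (forall z, a * F z <= k) ->
  a * \int[mu]_z ((\1_S z)%:E * F z) <= mu S * k.
Proof.
move=> k0 a0 Fk; rewrite -(integral_indicZr k0) -ge0_integralZl//; last first.
  by move=> z _; rewrite mule_ge0.
apply: ge0_le_integral => //.
- by move=> z _; rewrite !mule_ge0.
- exact: measurable_funeM.
- by move=> z _; rewrite muleCA lee_wpmul2l.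
Qed.

End integral_indicator.

(** Pointwise 2ab <= a^2 + b^2, trivially also where [q] is infinite; translation invariance then
    removes [z] from the right-hand side. *)
Lemma correlation_le (R : realType) d (p : 'cV[R]_d -> R) (q : 'cV[R]_d -> \bar R)
    (z : 'cV[R]_d) :
  measurable_fun setT p -> (forall x, 0 <= p x) ->
  measurable_fun setT q -> (forall x, 0 <= q x)%E ->
  (2%:E * \int[lebesgue_cV R d]_x ((p x)%:E * q (x + z)%R) <=
   \int[lebesgue_cV R d]_x (p x ^+ 2)%:E + \int[lebesgue_cV R d]_x (q x * q x))%E.
Proof.
move=> mp p0 mq q0.
have mpe : measurable_fun setT (EFin \o p) by exact/measurable_EFinP.
have msq : measurable_fun setT (fun x => (p x ^+ 2)%:E).
  by apply/measurable_EFinP; exact: measurable_funX.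
have mqz : measurable_fun setT (fun x : 'cV[R]_d => q (x + z)).
  by apply: (measurableT_comp mq); exact: measurable_cVD.
rewrite -(ge0_integral_translate z (f := fun x => q x * q x)%E); last 2 first.
- exact: emeasurable_funM.
- by move=> x; rewrite mule_ge0.
rewrite -ge0_integralD//; last 3 first.
- by move=> x _; rewrite lee_fin sqr_ge0.
- by move=> x _; rewrite mule_ge0.
- exact: emeasurable_funM.
rewrite -ge0_integralZl//; last 2 first.
- exact: emeasurable_funM.
- by move=> x _; rewrite mule_ge0// lee_fin.
apply: ge0_le_integral => //.
- by move=> x _; rewrite !mule_ge0// lee_fin.
- by apply: measurable_funeM; exact: emeasurable_funM.
- by apply: emeasurable_funD => //; exact: emeasurable_funM.
- move=> x _; have := q0 (x + z); case: (q _) => [r r0| _|//].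
    rewrite -!EFinM -EFinD lee_fin -subr_ge0.
    by rewrite (_ : _ - _ = (p x - r) ^+ 2) ?sqr_ge0//; ring.
  by rewrite mulyy addey ?leey.
Qed.

(** * A density compared with its spherical average *)

Section core.
Context {R : realType} {d : nat} (d_gt0 : (0 < d)%N).
Notation lam := (lebesgue_cV R d).
Notation V := ('cV[R]_d).
Variable sig : probability V R.
Hypothesis sigE : same_law sig uniform_sphere.
Variables (P : probability V R) (p : V -> R).
Hypotheses (density : has_density P p) (p_L2 : square_integrable p).
Local Open Scope ereal_scope.

(** The law of |X|U for independent X and U with laws [P] and [sig], as a bare set function. *)
Definition symmetrization (A : set V) : \bar R :=
  \int[P]_x sig ((fun u => enorm x *: u)%R @^-1` A).

Let mp : measurable_fun setT p. Proof. by case: density. Qed.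
Let p0 x : (0 <= p x)%R. Proof. by case: density. Qed.
Let PE A : measurable A -> P A = \int[lam]_(x in A) (p x)%:E.
Proof. by case: density => _ _; exact. Qed.

Let pe : V -> \bar R := EFin \o p.
Let mpe : measurable_fun setT pe. Proof. exact/measurable_EFinP. Qed.
Let pe0 x : 0 <= pe x. Proof. by rewrite lee_fin. Qed.

Let q := average sig pe.
Let mq : measurable_fun setT q. Proof. exact: measurable_average. Qed.
Let q0 x : 0 <= q x. Proof. exact: average_ge0. Qed.

Let ind (A : set V) : V -> \bar R := EFin \o \1_A.
Let mind A : measurable A -> measurable_fun setT (ind A).
Proof. by move=> mA; apply/measurable_EFinP; exact: measurable_indic. Qed.
Let ind0 A x : 0 <= ind A x. Proof. by rewrite lee_fin. Qed.

Lemma integral_indM (f : V -> \bar R) A : measurable A ->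
  \int[lam]_(x in A) f x = \int[lam]_x (ind A x * f x).
Proof.
move=> mA; rewrite integral_mkcond; apply: eq_integral => x _.
by rewrite patchE /ind /= indicE; case: ifPn => _; rewrite ?mul1e ?mul0e.
Qed.

Lemma symmetrization_average A : measurable A ->
  symmetrization A = \int[lam]_x (average sig (ind A) x * pe x).
Proof.
move=> mA; rewrite -(ge0_integral_density mp p0 PE).
- apply: eq_integral => x _; rewrite /average /ind /=.
  by rewrite integral_indic_comp//; exact: measurable_rescalel.
- exact: measurable_average (mind mA) (@ind0 A).
- by move=> x; exact: average_ge0.
Qed.

(** Symmetry moves the averaging from the indicator of [A] to the density. *)
Lemma symmetrization_density A : measurable A ->
  symmetrization A = \int[lam]_(x in A) q x.
Proof.
move=> mA; rewrite symmetrization_average// [RHS]integral_indM//.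
by rewrite /q (integral_averageC d_gt0 sigE (mind mA) (@ind0 A) mpe pe0).
Qed.

Let I2 := \int[lam]_x (p x ^+ 2)%:E.
Let Q2 := \int[lam]_x (q x * q x).

Let I2_fin : I2 \is a fin_num.
Proof.
have /integrableP[_] := p_L2; rewrite (eq_integral (fun x => (p x ^+ 2)%:E)).
  by rewrite ge0_fin_numE// integral_ge0// => x _; rewrite lee_fin sqr_ge0.
by move=> x _; rewrite gee0_abs// lee_fin sqr_ge0.
Qed.

Let msq : measurable_fun setT (fun x => (p x ^+ 2)%:E).
Proof. by apply/measurable_EFinP; exact: measurable_funX. Qed.

Let sq0 x : 0 <= (p x ^+ 2)%:E. Proof. by rewrite lee_fin sqr_ge0. Qed.

(* Expanding the integral of (p(x) - p(|x|u))^2 and using that averaging is a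
   symmetric projection, |p - q|^2 = |p|^2 - |q|^2. *)
Lemma symmetrization_eq_of_norm : I2 <= Q2 ->
  forall A, measurable A -> P A = symmetrization A.
Proof.
move=> IQ A mA.
pose rs (z : V * V) : V := (enorm z.1 *: z.2)%R.
have mrs : measurable_fun setT rs by exact: measurable_rescale.
have mp1 : measurable_fun setT (fun z : V * V => p z.1).
  by apply: (measurableT_comp mp); exact: measurable_fst.
have mp2 : measurable_fun setT (fun z : V * V => p (rs z)).
  exact: (measurableT_comp mp mrs).
pose D (z : V * V) : \bar R := ((p z.1 - p (rs z)) ^+ 2)%:E.
have mD : measurable_fun setT D.
  by apply/measurable_EFinP; apply: measurable_funX; exact: measurable_funB.
have D0 z : 0 <= D z by rewrite lee_fin sqr_ge0.
pose X (z : V * V) : \bar R := (2 * (p z.1 * p (rs z)))%:E.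
have mX : measurable_fun setT X.
  by apply/measurable_EFinP; apply: measurable_funM => //; exact: measurable_funM.
have X0 z : 0 <= X z by rewrite lee_fin !mulr_ge0.
(* Integrating u out turns the cross term into 2 p q, and the projection property replaces the
   integral of p q by that of q^2. *)
have IX : \int[lam \x sig]_z X z = 2%:E * Q2.
  rewrite (fubini_tonelli1 X)//.
  under eq_integral.
    move=> x _; rewrite /fubini_F /X /=.
    under eq_integral do rewrite mulrA EFinM.
    rewrite ge0_integralZl//; last 3 first.
    - by apply: (measurableT_comp mpe); exact: measurable_rescalel.
    - by move=> u _; exact: pe0.
    - by rewrite lee_fin mulr_ge0.
    rewrite EFinM -muleA.
    over.
  rewrite ge0_integralZl//=.
  - congr (_ * _).
    exact: (integral_mul_average d_gt0 sigE mpe pe0 mpe pe0).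
  - by apply: emeasurable_funM => //; exact: mq.
  - by move=> x _; apply: mule_ge0; [exact: pe0|exact: q0].
(* The sum [D] + [X] is p(x)^2 + p(|x|u)^2, and both terms integrate to |p|^2. This also covers an
   infinite |q|^2 without subtraction. *)
have ID : \int[lam \x sig]_z D z + 2%:E * Q2 = I2 + I2.
  rewrite -IX -ge0_integralD//.
  under eq_integral.
    move=> z _; rewrite /D /X -EFinD.
    rewrite (_ : (_ + _)%R = (p z.1 ^+ 2 + p (rs z) ^+ 2)%R); last by ring.
    over.
  rewrite (fubini_tonelli1 (fun z => (p z.1 ^+ 2 + p (rs z) ^+ 2)%:E)); last 2 first.
  - by apply/measurable_EFinP; apply: measurable_funD; exact: measurable_funX.
  - by move=> z; rewrite lee_fin addr_ge0// sqr_ge0.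
  under eq_integral.
    move=> x _; rewrite /fubini_F /=.
    under eq_integral do rewrite EFinD.
    rewrite ge0_integralD//; last first.
      by apply: (measurableT_comp msq); exact: measurable_rescalel.
    rewrite integral_cst// [X in _ * X + _]probability_setT mule1.
    over.
  rewrite ge0_integralD//; last 2 first.
  - by move=> x _; apply: integral_ge0 => u _; exact: sq0.
  - exact: (measurable_average sig (f := fun x => (p x ^+ 2)%:E)).
  congr (_ + _).
  exact: (integral_average d_gt0 sigE (f := fun x => (p x ^+ 2)%:E)).
have D_eq0 : \int[lam \x sig]_z `|D z| = 0.
  under eq_integral do rewrite gee0_abs//.
  apply/eqP; rewrite eq_le integral_ge0// andbT.
  have /lee_wpmul2l : (0 : \bar R) <= 2%:E by rewrite lee_fin.
  move=> /(_ _ _ IQ) IQ2.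
  have : \int[lam \x sig]_z D z + 2%:E * I2 <= 2%:E * I2.
    by rewrite [leRHS]mule_natl mule2n -ID leeD2l.
  by rewrite -[leRHS]add0e leeD2rE// fin_numM.
have pp : ae_eq (lam \x sig) setT D (cst 0).
  by apply/ae_eq_integral_abs.
rewrite PE// integral_indM//.
rewrite -(integral_average d_gt0 sigE (f := ind A \* pe)); last 2 first.
- by apply: emeasurable_funM => //; exact: mind.
- by move=> x; rewrite mule_ge0.
rewrite symmetrization_average//.
pose F1 z := ind A (rs z) * pe (rs z).
pose F2 z := ind A (rs z) * pe z.1.
have mF1 : measurable_fun setT F1.
  by apply: emeasurable_funM; apply: (measurableT_comp _ mrs) => //; exact: mind.
have mF2 : measurable_fun setT F2.
  apply: emeasurable_funM; first by apply: (measurableT_comp _ mrs); exact: mind.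
  exact/measurable_EFinP.
have F10 z : 0 <= F1 z by rewrite mule_ge0.
have F20 z : 0 <= F2 z by rewrite mule_ge0.
transitivity (\int[lam \x sig]_z F1 z); first by rewrite (fubini_tonelli1 F1).
(* The vanishing of [D] almost everywhere means p(x) = p(|x|u), so the density may be evaluated at x
   while the indicator stays at |x|u. *)
transitivity (\int[lam \x sig]_z F2 z).
  apply: ge0_ae_eq_integral => //.
  apply: filterS pp => z /(_ Logic.I) [] /eqP; rewrite sqrf_eq0 subr_eq0 => /eqP pz _.
  by rewrite /F1 /F2 /pe /= pz.
rewrite (fubini_tonelli1 F2)//; apply: eq_integral => x _.
rewrite /fubini_F /F2 /= muleC -ge0_integralZl//.
- by apply: eq_integral => u _; rewrite muleC.
- by apply: (measurableT_comp (mind mA)); exact: measurable_rescalel.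
Qed.

Let msub (x : V) : measurable_fun setT (fun y : V => (y - x)%R).
Proof. exact: measurable_cVB. Qed.

(** For independent X and Y with densities p and m, the difference Y - X has density z -> int p(x)
    m(x + z) dx, by y = x + z and Tonelli. Here [mu] is a mere set function, so that
    [symmetrization] is admissible. *)
Lemma integral_shifted (mu : set V -> \bar R) (m : V -> \bar R) (S : set V) :
  measurable_fun setT m -> (forall x, 0 <= m x) ->
  (forall A, measurable A -> mu A = \int[lam]_(x in A) m x) -> measurable S ->
  \int[P]_x mu ((fun y => y - x)%R @^-1` S) =
  \int[lam]_z (ind S z * \int[lam]_x (pe x * m (x + z)%R)).
Proof.
move=> mm m0 muE mS.
have madd : measurable_fun setT (fun z : V * V => (z.1 + z.2)%R).
  by apply: measurable_cVD; [exact: measurable_fst|exact: measurable_snd].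
pose H (z : V * V) := ind S z.2 * m (z.1 + z.2)%R.
have mS2 : measurable_fun setT (fun z : V * V => ind S z.2).
  by apply: (measurableT_comp (mind mS)); exact: measurable_snd.
have mH : measurable_fun setT H.
  by apply: emeasurable_funM => //; exact: (measurableT_comp mm).
have H0 z : 0 <= H z by rewrite mule_ge0.
have muH x : mu ((fun y => y - x)%R @^-1` S) = \int[lam]_z H (x, z).
  have mSx : measurable ((fun y => y - x)%R @^-1` S) by exact: measurable_preimageT.
  rewrite muE// integral_indM//.
  rewrite -(ge0_integral_translate x (f := fun y => ind _ y * m y)); last 2 first.
  - by apply: emeasurable_funM => //; exact: mind.
  - by move=> y; rewrite mule_ge0.
  apply: eq_integral => z _; rewrite /H /= addrC; congr (_ * _).
  rewrite /ind /= !indicE (_ : (_ \in _ @^-1` _) = (z \in S))//.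
  have xzS : ((fun y => y - x)%R @^-1` S) (x + z)%R = S z.
    by rewrite /preimage /= addrAC subrr add0r.
  by apply/idP/idP => /set_mem xS; apply/mem_set; [rewrite -xzS|rewrite xzS].
under eq_integral do rewrite muH.
rewrite (ge0_integral_density mp p0 PE); last 2 first.
- exact: (measurable_fun_fubini_tonelli_F H).
- by move=> x; exact: integral_ge0.
pose G (z : V * V) := ind S z.2 * (pe z.1 * m (z.1 + z.2)%R).
have mG : measurable_fun setT G.
  apply: emeasurable_funM => //; apply: emeasurable_funM.
    by apply: (measurableT_comp mpe); exact: measurable_fst.
  exact: (measurableT_comp mm).
have G0 z : 0 <= G z by rewrite !mule_ge0.
transitivity (\int[lam]_x \int[lam]_z G (x, z)).
  apply: eq_integral => x _; rewrite muleC -ge0_integralZl//.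
  - by apply: eq_integral => z _; rewrite /G /H /= muleCA.
  - exact: (measurableT_comp mH).
  - exact: pe0.
rewrite (fubini_tonelli G mG G0); apply: eq_integral => z _.
rewrite /G /= ge0_integralZl//.
- apply: emeasurable_funM => //.
  by apply: (measurableT_comp mm); exact: measurable_cVD.
- by move=> x _; rewrite mule_ge0.
Qed.

(* On a small set S the autocorrelation of p is at least |p|^2 - eps, whereas the
   correlation of p with q is everywhere at most (|p|^2 + |q|^2) / 2. *)
Lemma norm_le_of_small_sets :
  (forall del : R, (0 < del)%R -> exists S : set V,
    [/\ measurable S, S `<=` centered_cube del, 0 < lam S &
      \int[P]_x P ((fun y => y - x)%R @^-1` S) =
      \int[P]_x symmetrization ((fun y => y - x)%R @^-1` S)]) ->
  I2 <= Q2.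
Proof.
move=> small; apply/lee_addgt0Pr => e e0.
(* Half of e, because the lower bound is doubled before it meets the bound on twice the other
   correlation. *)
have e20 : (0 < e / 2)%R by rewrite divr_gt0.
have I2oo : I2 < +oo by rewrite -ge0_fin_numE// integral_ge0.
have [del del0 Hdel] := autocorrelation_lower_bound mp p0 I2oo e20.
have [S [mS Sdel S0]] := small del del0.
have Sfin : lam S \is a fin_num.
  by rewrite ge0_fin_numE//; exact: lebesgue_subcube_fin Sdel.
rewrite (integral_shifted mpe pe0 PE mS).
rewrite (integral_shifted mq q0 symmetrization_density mS).
set A := LHS; set A' := RHS => AA'.
have corr0 (m : V -> \bar R) z : (forall x, 0 <= m x) ->
    0 <= \int[lam]_x (pe x * m (x + z)%R).
  by move=> m0; apply: integral_ge0 => x _; rewrite mule_ge0.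
have mcorr (m : V -> \bar R) : measurable_fun setT m -> (forall x, 0 <= m x) ->
    measurable_fun setT (fun z => \int[lam]_x (pe x * m (x + z)%R)).
  move=> mm m0.
  apply: (measurable_fun_fubini_tonelli_G (fun z : V * V => pe z.1 * m (z.1 + z.2)%R)).
  - apply: emeasurable_funM.
      by apply: (measurableT_comp mpe); exact: measurable_fst.
    apply: (measurableT_comp mm).
    by apply: measurable_cVD; [exact: measurable_fst|exact: measurable_snd].
  - by move=> z; rewrite mule_ge0.
have I20 : 0 <= I2 by exact: integral_ge0.
have Q20 : 0 <= Q2 by apply: integral_ge0 => x _; rewrite mule_ge0.
have eE : 0 <= e%:E by rewrite lee_fin ltW.
have e2E : 0 <= (e / 2)%:E by rewrite lee_fin ltW.
have lower : lam S * I2 <= A + lam S * (e / 2)%:E.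
  have corrS z : S z -> I2 <= \int[lam]_x (pe x * pe (x + z)%R) + (e / 2)%:E.
    by move=> /Sdel; exact: Hdel.
  exact: (le_integral_indic lam mS (mcorr pe mpe pe0) (fun z => corr0 pe z pe0)
    I20 e2E corrS).
have upper : 2%:E * A' <= lam S * (I2 + Q2).
  have two0 : (0 : \bar R) <= 2%:E by rewrite lee_fin.
  exact: (integral_indic_le lam mS (mcorr q mq q0) (fun z => corr0 q z q0)
    (adde_ge0 I20 Q20) two0 (fun z => correlation_le z mp p0 mq q0)).
have : lam S * (I2 + I2) <= lam S * (I2 + Q2 + e%:E).
  rewrite (ge0_muleDr (lam S) I20 I20).
  rewrite (ge0_muleDr (lam S) (adde_ge0 I20 Q20) eE).
  apply: le_trans (leeD lower lower) _; rewrite addeACA -[X in _ + X <= _]ge0_muleDr// -EFinD -splitr.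
  by rewrite leeD2r// -mule2n -mule_natl AA'.
by rewrite (lee_pmul2l Sfin S0) -addeA leeD2lE.
Qed.

Lemma eq_symmetrization :
  (forall del : R, (0 < del)%R -> exists S : set V,
    [/\ measurable S, S `<=` centered_cube del, 0 < lam S &
      \int[P]_x P ((fun y => y - x)%R @^-1` S) =
      \int[P]_x symmetrization ((fun y => y - x)%R @^-1` S)]) ->
  forall A, measurable A -> P A = symmetrization A.
Proof. by move=> small; exact/symmetrization_eq_of_norm/norm_le_of_small_sets. Qed.

End core.

(** * Rotations *)

(** The Householder reflection in the hyperplane orthogonal to w = x - y. Equal norms give w.w = 2
    w.x, so it sends x to x - w = y. *)
Lemma orthogonal_reflection (R : realType) d (x y : 'cV[R]_d) :
  enorm x = enorm y -> exists2 H : 'M[R]_d, orthogonal_mx H & H *m x = y.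
Proof.
move=> xy; have [->|nxy] := eqVneq x y.
  by exists 1%:M; rewrite ?mul1mx// /orthogonal_mx trmx1 mulmx1.
pose w := x - y; pose dot (a b : 'cV[R]_d) : R := (a^T *m b) ord0 ord0.
have dotE (a b : 'cV[R]_d) : a^T *m b = (dot a b)%:M by exact: mx11_scalar.
have dot_enorm a : dot a a = enorm a ^+ 2.
  by rewrite sqr_enorm /dot mxE; apply: eq_bigr => i _; rewrite mxE expr2.
have dotC a b : dot a b = dot b a.
  by rewrite /dot -[in RHS](trmxK a) -trmx_mul [RHS]mxE.
have dotBl a b c : dot (a - b) c = dot a c - dot b c.
  by rewrite /dot linearB mulmxBl !mxE.
have ww : dot w w = 2 * dot w x.
  have wE c : dot w c = dot x c - dot y c by exact: dotBl.
  by rewrite wE (dotC x w) (dotC y w) !wE !dot_enorm xy (dotC y x); ring.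
have w0 : dot w w != 0 by rewrite dot_enorm sqrf_eq0 enorm_eq0 subr_eq0.
pose H := 1%:M - (2 / dot w w) *: (w *m w^T).
have HT : H^T = H by rewrite /H linearB linearZ /= trmx1 trmx_mul trmxK.
exists H.
  rewrite /orthogonal_mx HT {1}/H mulmxBl mul1mx.
  suff -> : (2 / dot w w) *: (w *m w^T) *m H = - ((2 / dot w w) *: (w *m w^T)).
    by rewrite opprK subrK.
  rewrite /H mulmxBr mulmx1 -scalemxAl -scalemxAr scalerA -mulmxA (mulmxA w^T) dotE.
  rewrite mul_scalar_mx -scalemxAr scalerA -scalerBl -[RHS]scaleNr.
  by congr (_ *: _); field.
rewrite /H mulmxBl mul1mx -scalemxAl -mulmxA dotE mul_mx_scalar scalerA ww.
rewrite (_ : _ * _ = 1) ?scale1r ?subKr//.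
by rewrite ww in w0; move: w0; rewrite mulf_eq0 negb_or => /andP[_ w0]; field.
Qed.

Section rotation.
Context {R : realType} {d : nat} (d_gt0 : (0 < d)%N).
Notation lam := (lebesgue_cV R d).
Notation V := ('cV[R]_d).
Variable sig : probability V R.
Hypothesis sigE : same_law sig uniform_sphere.

(** The unit ball is invariant under x -> - H x, so its volume, positive and finite, cancels from
    the additivity identity. *)
Lemma lebesgue_cV_orthogonal (H : 'M[R]_d) A : orthogonal_mx H -> measurable A ->
  lam ((fun x => H *m x) @^-1` A) = lam A.
Proof.
move=> HH mA.
have := @lebesgue_cV_additive R d (fun x => H *m x) (fun x => H^T *m x) A (eball 1).
rewrite (_ : (fun x : V => - (H *m x)) @^-1` eball 1 = eball 1); last first.
  by apply/seteqP; split => x; rewrite /eball /= enormN enorm_orthogonal.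
have b0 := unit_ball_gt0 sigE.
have bfin : lam (eball 1) \is a fin_num.
  by rewrite ge0_fin_numE//; exact: lebesgue_eball_fin.
move=> E; apply/eqP; rewrite eq_le.
rewrite -(lee_pmul2r bfin b0) -[X in _ && X](lee_pmul2r bfin b0) E ?lexx//.
- by move=> x y; rewrite mulmxDr.
- by move=> x; rewrite mulmxA (mulmx1C HH) mul1mx.
- exact: measurable_cVmul.
- exact: measurable_cVmul.
- exact: measurable_eball.
Qed.

Lemma uniform_sphere_orthogonal (H : 'M[R]_d) A : orthogonal_mx H -> measurable A ->
  sig ((fun x => H *m x) @^-1` A) = sig A.
Proof.
move=> HH mA.
have mHA : measurable ((fun x : V => H *m x) @^-1` A).
  by apply: measurable_preimageT => //; exact: measurable_cVmul.
rewrite !(uniform_sphereE sigE)//; congr (_ * _)%E.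
rewrite -[RHS](lebesgue_cV_orthogonal HH); last exact: (measurable_sector 1 mA).
by congr (lam _); apply/seteqP; split => x; rewrite /cone /= enorm_orthogonal// -scalemxAr.
Qed.

Lemma symmetrization_orthogonal (P : probability V R) (H : 'M[R]_d) A :
  orthogonal_mx H -> measurable A ->
  symmetrization sig P ((fun x => H *m x) @^-1` A) = symmetrization sig P A.
Proof.
move=> HH mA; apply: eq_integral => x _.
rewrite -[RHS](uniform_sphere_orthogonal HH); last first.
  by apply: measurable_preimageT => //; exact: measurable_rescalel.
by congr (sig _); apply/seteqP; split => u; rewrite /= scalemxAr.
Qed.

(** The additivity identity for the dilation by 1/r reads lam (ball r) lam (ball 1/r) = lam (ball
    1)^2, and the right-hand side is positive. *)
Lemma lebesgue_eball_gt0 r : 0 < r -> (0 < lam (eball r))%E.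
Proof.
move=> r0; have rV : 0 < r^-1 by rewrite invr_gt0.
have ballE (a b : R) : 0 < a ->
    (fun x : V => a *: x) @^-1` eball b = eball (a^-1 * b).
  by move=> a0; apply/seteqP; split => x; rewrite /eball /= enormZ gtr0_norm// ler_pdivlMl.
have := @lebesgue_cV_additive R d (fun x => r^-1 *: x) (fun x => r *: x)
  (eball 1) (eball r^-1).
rewrite ballE// (_ : (fun x : V => - (r^-1 *: x)) @^-1` eball r^-1 = eball 1); last first.
  rewrite (_ : _ @^-1` _ = (fun x : V => r^-1 *: x) @^-1` eball r^-1).
    by rewrite ballE// invrK mulfV// gt_eqF.
  by apply/seteqP; split => x; rewrite /eball /= enormN.
rewrite invrK mulr1 => E.
rewrite lt_neqAle measure_ge0 andbT eq_sym; apply/eqP => r_null.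
move: E; rewrite r_null mul0e => E.
have : (0 < lam (eball 1) * lam (eball 1))%E by rewrite mule_gt0//; exact: unit_ball_gt0 sigE.
rewrite -E ?ltxx//.
- by move=> x y; rewrite scalerDr.
- by move=> x; rewrite scalerA mulVf ?scale1r// gt_eqF.
- exact: measurable_cVZ.
- exact: measurable_cVZ.
- exact: measurable_eball.
- exact: measurable_eball.
Qed.

(* The P-measure of a Euclidean ball depends only on its radius and on the norm
   of its center, so averaging the center over a sphere does not change it. *)
Lemma spherically_symmetric_ball (P : probability V R) r :
  spherically_symmetric P ->
  (\int[P]_x P ((fun y => y - x)%R @^-1` eball r) =
   \int[P]_x symmetrization sig P ((fun y => y - x)%R @^-1` eball r))%E.
Proof.
move=> PH.
pose F (x : V) := P ((fun y => y - x) @^-1` eball r).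
have mball (x : V) : measurable ((fun y => y - x) @^-1` eball r).
  by apply: measurable_preimageT; [exact: measurable_cVB|exact: measurable_eball].
have Frad x y : enorm x = enorm y -> F x = F y.
  move=> /orthogonal_reflection[H HH Hxy].
  rewrite /F -[RHS](PH H HH)//; congr (P _); apply/seteqP; split => z /=;
    by rewrite /eball /= -Hxy -mulmxBr enorm_orthogonal.
have mind dT (T : measurableType dT) (g : T -> V) : measurable_fun setT g ->
    measurable_fun setT (fun x => (\1_(eball r) (g x) : R)%:E).
  move=> mg; apply/measurable_EFinP.
  exact: (measurableT_comp (measurable_indic (measurable_eball r)) mg).
pose J (z : V * (V * V)) : \bar R := (\1_(eball r) (enorm z.2.1 *: z.2.2 - z.1))%:E.
have mJ : measurable_fun setT J.
  apply: mind; apply: measurable_cVB; last exact: measurable_fst.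
  by apply: (measurableT_comp measurable_rescale); exact: measurable_snd.
have J0 z : (0 <= J z)%E by rewrite lee_fin.
(* The ball is symmetric about 0, so the point and the center may exchange roles. *)
have FE x : (F x = \int[P]_y (\1_(eball r) (x - y)%R : R)%:E)%E.
  rewrite integral_indic_comp; [|exact: measurable_cVB|exact: measurable_eball].
  by congr (P _); apply/seteqP; split => y; rewrite /eball /= -enormN opprB.
have mF : measurable_fun setT F.
  pose J' (z : V * V) : \bar R := (\1_(eball r) (z.1 - z.2)%R)%:E.
  have mJ' : measurable_fun setT J'.
    by apply: mind; apply: measurable_cVB; [exact: measurable_fst|exact: measurable_snd].
  rewrite (_ : F = fubini_F P J'); last by apply/funext => x; rewrite FE.
  by apply: measurable_fun_fubini_tonelli_F => // z; rewrite lee_fin.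
have F0 x : (0 <= F x)%E by exact: measure_ge0.
transitivity (\int[P]_y \int[sig]_u F (enorm y *: u)%R)%E.
  apply: eq_integral => y _.
  transitivity (average sig (cst 1%E \* F)%E y).
    rewrite (average_radial sigE)// /average integral_cst//.
    by rewrite [X in (_ * X * _)%E]probability_setT !mul1e.
  by apply: eq_integral => u _ /=; rewrite mul1e.
pose FF (z : V * V) := F (enorm z.1 *: z.2).
have mFF : measurable_fun setT FF by exact: (measurableT_comp mF measurable_rescale).
rewrite -(fubini_tonelli1 FF)//.
(* The pair (y, u) is treated as a single variable, so that it can be exchanged with x in one
   application of Tonelli; |y|u then changes from center to point. *)
pose PS : {sigma_finite_measure set (V * V)%type -> \bar R} :=
  product_subprobability (P : subprobability V R, sig : subprobability V R).
transitivity (\int[PS]_z \int[P]_x J (x, z))%E.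
  by apply: eq_integral => z _; rewrite /FF FE.
rewrite -(fubini_tonelli (m1 := P) (m2 := PS) J mJ J0); apply: eq_integral => x _.
rewrite [LHS](fubini_tonelli1 (m1 := P) (m2 := sig) (fun z => J (x, z)))//; last first.
  exact: (measurableT_comp mJ).
apply: eq_integral => y _; rewrite /fubini_F /J /=.
rewrite (integral_indic_comp _ (g := fun u : V => enorm y *: u - x))//.
  by apply: measurable_cVB => //; exact: measurable_cVZ.
exact: measurable_eball.
Qed.

End rotation.

(** * Joint laws *)

Lemma measurable_fun_pairT d d1 d2 (T : measurableType d) (T1 : measurableType d1)
    (T2 : measurableType d2) (f : T -> T1) (g : T -> T2) :
  measurable_fun setT f -> measurable_fun setT g ->
  measurable_fun setT (fun x => (f x, g x)).
Proof. by move=> mf mg; apply/measurable_fun_pair. Qed.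

Lemma product_law (R : realType) dO (Omega : measurableType dO)
    (Pr : probability Omega R) dT (T : measurableType dT) dT' (T' : measurableType dT')
    (mu : {sigma_finite_measure set T -> \bar R})
    (nu : {sigma_finite_measure set T' -> \bar R}) (X : Omega -> T) (Y : Omega -> T') :
  measurable_fun setT X -> measurable_fun setT Y ->
  (forall A B, measurable A -> measurable B ->
    Pr (X @^-1` A `&` Y @^-1` B) = (mu A * nu B)%E) ->
  forall E, measurable E -> Pr ((fun w => (X w, Y w)) @^-1` E) = (mu \x nu)%E E.
Proof.
move=> mX mY XY E mE; apply/esym.
rewrite -[RHS]/(pushforward_measure Pr (measurable_fun_pairT mX mY) E).
by apply: product_measure_unique.
Qed.

Section variants.
Context {R : realType} {d : nat}.
Notation V := ('cV[R]_d).
Context {dO : measure_display} {Omega : measurableType dO} (Pr : probability Omega R).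
Variables (X1 X2 U1 U2 : {RV Pr >-> V}) (P sig : probability V R).
Hypotheses (lawX1 : same_law (distribution Pr X1) P)
  (lawX2 : same_law (distribution Pr X2) P)
  (indepX : independent_vars Pr X1 X2)
  (lawU1 : same_law (distribution Pr U1) sig)
  (lawU2 : same_law (distribution Pr U2) sig)
  (indepU : independent_vars Pr U1 U2)
  (indepUX : independent_vars Pr (fun w => (U1 w, U2 w)) (fun w => (X1 w, X2 w))).

Let k (f : V -> V -> V) (A : set V) : \bar R := (\int[P]_x sig ((f x) @^-1` A))%E.

(** The vectors (X1, X2) and (U1, U2) have product laws and are independent; for fixed (x1, x2) the
    event is a rectangle in (u1, u2), so its probability factors. Letting [f] ignore its second
    argument includes the unchanged vector X1. *)
Lemma independent_transforms (f g : V -> V -> V) A B :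
  measurable_fun setT (fun z : V * V => f z.1 z.2) ->
  measurable_fun setT (fun z : V * V => g z.1 z.2) ->
  measurable A -> measurable B ->
  Pr ((fun w => f (X1 w) (U1 w)) @^-1` A `&` (fun w => g (X2 w) (U2 w)) @^-1` B) =
  (k f A * k g B)%E.
Proof.
move=> mf mg mA mB.
pose PP : {sigma_finite_measure set (V * V)%type -> \bar R} :=
  product_subprobability (P : subprobability V R, P : subprobability V R).
pose SS : {sigma_finite_measure set (V * V)%type -> \bar R} :=
  product_subprobability (sig : subprobability V R, sig : subprobability V R).
have mX : measurable_fun setT (fun w => (X1 w, X2 w)).
  by apply: measurable_fun_pairT; exact: measurable_funP.
have mU : measurable_fun setT (fun w => (U1 w, U2 w)).
  by apply: measurable_fun_pairT; exact: measurable_funP.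
have lawX E : measurable E -> Pr ((fun w => (X1 w, X2 w)) @^-1` E) = (P \x P)%E E.
  apply: product_law; [exact: measurable_funP|exact: measurable_funP|].
  by move=> C D mC mD; rewrite indepX//; congr (_ * _)%E; [exact: lawX1|exact: lawX2].
have lawU E : measurable E -> Pr ((fun w => (U1 w, U2 w)) @^-1` E) = (sig \x sig)%E E.
  apply: product_law; [exact: measurable_funP|exact: measurable_funP|].
  by move=> C D mC mD; rewrite indepU//; congr (_ * _)%E; [exact: lawU1|exact: lawU2].
have m11 : measurable_fun setT (fun z : (V * V) * (V * V) => (z.1.1, z.2.1)).
  apply: measurable_fun_pairT; apply: (measurableT_comp measurable_fst).
    exact: measurable_fst.
  exact: measurable_snd.
have m22 : measurable_fun setT (fun z : (V * V) * (V * V) => (z.1.2, z.2.2)).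
  apply: measurable_fun_pairT; apply: (measurableT_comp measurable_snd).
    exact: measurable_fst.
  exact: measurable_snd.
pose E : set ((V * V) * (V * V)) :=
  (fun z => f z.1.1 z.2.1) @^-1` A `&` (fun z => g z.1.2 z.2.2) @^-1` B.
have mE : measurable E.
  apply: measurableI; apply: measurable_preimageT => //.
    exact: (measurableT_comp mf m11).
  exact: (measurableT_comp mg m22).
transitivity ((PP \x SS)%E E).
  rewrite -(product_law (X := fun w => (X1 w, X2 w)) (Y := fun w => (U1 w, U2 w)) (Pr := Pr))//.
  move=> C D mC mD; rewrite setIC indepUX// muleC; congr (_ * _)%E.
    exact: lawX.
  exact: lawU.
have mk (l : V -> V -> V) C : measurable_fun setT (fun z : V * V => l z.1 z.2) ->
    measurable C -> measurable_fun setT (fun x => sig ((l x) @^-1` C)).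
  move=> ml mC; pose L (z : V * V) : \bar R := (\1_C (l z.1 z.2))%:E.
  have mL : measurable_fun setT L.
    apply/measurable_EFinP; exact: (measurableT_comp (measurable_indic mC) ml).
  rewrite (_ : (fun x => _) = fubini_F sig L).
    by apply: measurable_fun_fubini_tonelli_F => // z; rewrite lee_fin.
  apply/funext => x; rewrite /fubini_F /L /= integral_indic_comp//.
  exact: (measurableT_comp ml (measurable_pair1 x)).
rewrite /product_measure1 /=.
pose F (z : V * V) := (sig ((f z.1) @^-1` A) * sig ((g z.2) @^-1` B))%E.
have mF : measurable_fun setT F.
  apply: emeasurable_funM.
    by apply: (measurableT_comp (mk f A mf mA)); exact: measurable_fst.
  by apply: (measurableT_comp (mk g B mg mB)); exact: measurable_snd.
transitivity (\int[P \x P]_z F z)%E.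
  apply: eq_integral => z _ /=.
  have mfz : measurable (f z.1 @^-1` A).
    by apply: measurable_preimageT => //; exact: (measurableT_comp mf (measurable_pair1 _)).
  have mgz : measurable (g z.2 @^-1` B).
    by apply: measurable_preimageT => //; exact: (measurableT_comp mg (measurable_pair1 _)).
  transitivity ((sig \x sig)%E ((f z.1 @^-1` A) `*` (g z.2 @^-1` B))).
    congr (_ _); apply/seteqP; split => u; rewrite /xsection /=.
      by move=> /set_mem.
    by move=> ?; apply/mem_set.
  exact: product_measure1E.
rewrite (fubini_tonelli1 F)//; last by move=> z; rewrite mule_ge0.
rewrite /k muleC -ge0_integralZl//; last 2 first.
- exact: mk.
- by apply: integral_ge0.
apply: eq_integral => x _; rewrite /fubini_F /F /= ge0_integralZl//.
- by rewrite muleC.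
- exact: mk.
Qed.

End variants.

(** Since 0 belongs to [S t], the norm of each of its points is at most the diameter. *)
Lemma small_sublevel_set (R : realType) d (S : R -> set 'cV[R]_d) (del : R) :
  shrinks_regularly S -> (forall t, 0 < t -> S t 0) -> 0 < del ->
  exists2 t, 0 < t & S t `<=` centered_cube del.
Proof.
move=> [_ _ Sdiam _] S0 del0.
have del0' : (0 < del%:E)%E by rewrite lte_fin.
have t_gt0 : \forall t \near (0 : R)^'+, 0 < t by exact: nbhs_right_gt.
have [t [t0 /= St]] := filter_ex (filterI t_gt0 (Sdiam _ (open_ereal_lt' del0'))).
exists t => // x Sx; apply: eball_cube; rewrite /eball /= -lee_fin -[x]subr0.
apply: le_trans (ltW St); apply: ereal_sup_ubound.
by exists (x, 0) => //; split => //=; exact: S0.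
Qed.

(** The preimage under a constant map is everything or empty. This evaluates the mixture law when
    the transform ignores the direction. *)
Lemma integral_measure_const_preimage (R : realType) d1 (T : measurableType d1) d2
    (T' : measurableType d2) (mu : {measure set T -> \bar R}) (sig : probability T' R) A :
  measurable A -> (\int[mu]_x sig ((fun=> x) @^-1` A) = mu A)%E.
Proof.
move=> mA; rewrite -[in RHS](setIT A) -integral_indic//; apply: eq_integral => x _.
have [xA|xA] := pselect (A x).
  rewrite indicE mem_set// (_ : _ @^-1` _ = setT) ?probability_setT//.
  by apply/seteqP; split.
rewrite indicE memNset// (_ : _ @^-1` _ = set0) ?measure0//.
by apply/seteqP; split.
Qed.

Theorem lemma2p2 (R : realType) (d : nat) (hd : (2 <= d)%N)
  (dO : measure_display) (Omega : measurableType dO) (Pr : probability Omega R)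
  (X1 X2 U1 U2 : {RV Pr >-> 'cV[R]_d})
  (P : probability 'cV[R]_d R) (p : 'cV[R]_d -> R)
  (* X1, X2 are i.i.d. with distribution P *)
  (lawX1 : same_law (distribution Pr X1) P)
  (lawX2 : same_law (distribution Pr X2) P)
  (indepX : independent_vars Pr X1 X2)
  (* U1, U2 are i.i.d. uniform on the sphere, independent of (X1, X2) *)
  (lawU1 : same_law (distribution Pr U1) uniform_sphere)
  (lawU2 : same_law (distribution Pr U2) uniform_sphere)
  (indepU : independent_vars Pr U1 U2)
  (indepUX : independent_vars Pr (fun w => (U1 w, U2 w)) (fun w => (X1 w, X2 w)))
  (density : has_density P p) (p_L2 : square_integrable p)
  (h : 'cV[R]_d -> 'cV[R]_d -> R)
  (mh : measurable_fun setT (fun z : 'cV[R]_d * 'cV[R]_d => h z.1 z.2))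
  (ha : forall x y, h x y = 0 <-> x = y)
  (hb : forall a x y, h (x + a) (y + a) = h x y)
  (hc : shrinks_regularly (fun t : R => [set x | h 0 x <= t])) :
  let X1' := spherical_variant X1 U1 in
  let X2' := spherical_variant X2 U2 in
  (eq_in_law Pr (fun w => h (X1 w) (X2 w)) (fun w => h (X1 w) (X2' w)) /\
   eq_in_law Pr (fun w => h (X1 w) (X2' w)) (fun w => h (X1' w) (X2' w)))
  <-> spherically_symmetric P.
Proof.
move=> X1' X2'.
have d_gt0 : (0 < d)%N by exact: ltn_trans hd.
(* The set function [uniform_sphere] enters as a probability through the law of [U1]. *)
pose sig : probability 'cV[R]_d R := distribution Pr U1.
have sigE : same_law sig uniform_sphere by exact: lawU1.
have lawU2' : same_law (distribution Pr U2) sig.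
  by move=> A mA; rewrite lawU2// -lawU1.
have mX1 : measurable_fun setT X1 by exact: measurable_funP.
have mX2 : measurable_fun setT X2 by exact: measurable_funP.
have mX1' : measurable_fun setT X1'.
  apply: measurable_cVZ; last exact: measurable_funP.
  by apply: measurable_enorm; exact: measurable_funP.
have mX2' : measurable_fun setT X2'.
  apply: measurable_cVZ; last exact: measurable_funP.
  by apply: measurable_enorm; exact: measurable_funP.
pose sym := symmetrization sig P.
have indep f g A B := @independent_transforms R d dO Omega Pr X1 X2 U1 U2 P sig
  lawX1 lawX2 indepX (fun _ _ => erefl) lawU2' indepU indepUX f g A B.
have law12 A B : measurable A -> measurable B ->
    Pr (X1 @^-1` A `&` X2' @^-1` B) = (P A * sym B)%E.
  move=> mA mB; rewrite (indep (fun x _ => x) (fun x u => enorm x *: u))//.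
  - by rewrite integral_measure_const_preimage.
  - exact: measurable_fst.
  - exact: measurable_rescale.
have law22 A B : measurable A -> measurable B ->
    Pr (X1' @^-1` A `&` X2' @^-1` B) = (sym A * sym B)%E.
  move=> mA mB; apply: (indep (fun x u => enorm x *: u) (fun x u => enorm x *: u)) => //;
    exact: measurable_rescale.
have law11 A B : measurable A -> measurable B ->
    Pr (X1 @^-1` A `&` X2 @^-1` B) = (P A * P B)%E.
  by move=> mA mB; rewrite indepX//; congr (_ * _)%E; [exact: lawX1|exact: lawX2].
split=> [[eqlaw _]|PH].
  have PE : forall A, measurable A -> P A = sym A.
    apply: (eq_symmetrization d_gt0 sigE density p_L2) => del del0.
    have [mS S0 _ _] := hc.
    have [|t t0 Sdel] := small_sublevel_set hc _ del0.
      by move=> t t0 /=; rewrite (ha 0 0).2 ?ltW.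
    exists [set x | h 0 x <= t]; split=> //; [exact: mS|exact: S0|].
    pose E : set ('cV[R]_d * 'cV[R]_d) := (fun z => h z.1 z.2) @^-1` `]-oo, t]%classic.
    have mE : measurable E by exact: measurable_preimageT.
    (* Invariance of [h] under common translations makes every section a translate of one sublevel
       set. *)
    have xE x : xsection E x = (fun y => y - x) @^-1` [set x | h 0 x <= t].
      have hE y : h x y = h 0 (y - x) by rewrite -(hb x 0) add0r subrK.
      apply/seteqP; split => y; rewrite /xsection /E /=.
        by move=> /set_mem /=; rewrite in_itv/= hE.
      by move=> hyx; apply/mem_set; rewrite /= in_itv/= hE.
    (* Since [sym] is only a set function, the product with [P] is taken with the law of [X2'], a
       genuine measure with the same values. *)
    pose mY := isMeasurableFun.Build _ _ _ _ X2' mX2'.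
    pose Y : {RV Pr >-> 'cV[R]_d} := HB.pack X2' mY.
    pose D : probability 'cV[R]_d R := distribution Pr Y.
    have DE B : measurable B -> D B = sym B.
      move=> mB; have := law12 setT B measurableT mB.
      by rewrite preimage_setT setTI probability_setT mul1e.
    transitivity ((P \x P)%E E).
      by apply: eq_integral => x _; rewrite /= xE.
    transitivity ((P \x D)%E E); last first.
      apply: eq_integral => x _; rewrite /= DE; last exact: measurable_xsection.
      by rewrite xE.
    rewrite -(product_law mX1 mX2 law11 mE).
    have law12D A B : measurable A -> measurable B ->
        Pr (X1 @^-1` A `&` X2' @^-1` B) = (P A * D B)%E.
      by move=> mA mB; rewrite law12// DE.
    rewrite -[RHS](product_law mX1 mX2' law12D mE).
    exact: (eqlaw `]-oo, t]%classic (measurable_itv _)).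
  move=> H HH A mA; rewrite /pushforward !PE//.
    exact: symmetrization_orthogonal.
  by apply: measurable_preimageT => //; exact: measurable_cVmul.
have PE : forall A, measurable A -> P A = sym A.
  apply: (eq_symmetrization d_gt0 sigE density p_L2) => del del0.
  exists (eball del); split.
  - exact: measurable_eball.
  - exact: eball_cube.
  - exact: lebesgue_eball_gt0 sigE _ del0.
  - exact: spherically_symmetric_ball.
have law12' A B : measurable A -> measurable B ->
    Pr (X1 @^-1` A `&` X2' @^-1` B) = (P A * P B)%E.
  by move=> mA mB; rewrite law12// !PE.
have law22' A B : measurable A -> measurable B ->
    Pr (X1' @^-1` A `&` X2' @^-1` B) = (P A * P B)%E.
  by move=> mA mB; rewrite law22// !PE.
have mpre B : measurable B ->
    measurable ((fun z : 'cV[R]_d * 'cV[R]_d => h z.1 z.2) @^-1` B).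
  by move=> mB; exact: measurable_preimageT.
split=> B mB; have mE := mpre B mB.
  exact: etrans (product_law mX1 mX2 law11 mE) (esym (product_law mX1 mX2' law12' mE)).
exact: etrans (product_law mX1 mX2' law12' mE) (esym (product_law mX1' mX2' law22' mE)).
Qed.
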